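(* Let $K$ be a prime link diagram without curls, let $i\in K_1$ be a segment of $K$, and let $T(i)$ be the associated representation with basis $B(i)$. Then the poset of join irreducible Kauffman states relative to the segment $i$ is isomorphic to the poset of the coefficient quiver $\Gamma(T(i),B(i))$ of the representation $T(i)$.
   Context: Link diagrams. A link diagram $K$ is a projection of a link to the plane that is injective except for finitely many transversal double points (crossing points). It is regarded as a cellular decomposition of the oriented sphere $S^2$: $K_0$ is the set of crossing points (nonempty), $K_1$ the set of segments (edges; every crossing point is incident to four segments and every segment to two crossing points), $K_2$ the set of regions of the complement; $|K_1|=2|K_0|$ and $|K_2|=|K_0|+2$ (so $K$ is connected). A curl is a monogon region; $K$ is without curls if it has no monogon. ''Prime link diagram'' means: the link is prime (not the connected sum of two nontrivial links), and the diagram is prime, i.e. every simple closed curve in $S^2$ meeting $K$ transversally in exactly two points, both interior points of segments, bounds on one side a disc containing no crossing points. ''Clockwise'' is with respect to the fixed orientation of the plane. Kauffman states. Let $i\in K_1$, with adjacent regions $R_i,R_i'$. A marker is a pair $(x,R)$ with $x\in K_0$, $R\in K_2$, $x$ incident to $R$. A Kauffman state relative to $i$ is a set of markers such that each crossing point is used in exactly one marker, each region other than $R_i,R_i'$ is used in exactly one marker, and $R_i,R_i'$ are used in no marker. Let $j$ be a segment with endpoints $x,y$ and adjacent regions $R_1,R_2$ such that going clockwise around $x$ one passes from $R_1$ to $R_2$ when crossing $j$. A state $\mathcal S'$ is obtained from $\mathcal S$ by a counterclockwise transposition at $j$ if $\mathcal S$ contains $(x,R_2),(y,R_1)$, $\mathcal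 S'$ contains $(x,R_1),(y,R_2)$, and all other markers agree. Put $\mathcal S_1<\mathcal S_2$ if a (nonempty) sequence of counterclockwise transpositions transforms $\mathcal S_1$ into $\mathcal S_2$. This is a partial order with a unique minimal and a unique maximal element (Kauffman), and the resulting poset $L(i)$ is a lattice. Join irreducibles. An element $c$ of a lattice is join irreducible if it is not the minimum and $c=a\vee b$ implies $c=a$ or $c=b$. The set of join irreducible Kauffman states carries the order induced from $L(i)$. The quiver $Q$. Its vertices are the segments, $Q_0=K_1$. For every crossing point with segments $a_1,a_2,a_3,a_4$ in clockwise order draw arrows $a_1\to a_2\to a_3\to a_4\to a_1$; then remove all 2-cycles. Each remaining arrow $\alpha:j\to k$ corresponds to a position $(x,R)$ in the diagram: the region $R$ at the crossing point $x$ lying between $j$ and the next segment $k$ in clockwise direction. The representation $T(i)=(T(i)_j,\phi_\alpha)$ of $Q$ over an algebraically closed field $\Bbbk$. For $j\in K_1$ let $d_j=\dim T(i)_j$ be the number of transpositions at $j$ in any sequence of counterclockwise transpositions from the minimal to the maximal Kauffman state relative to $i$ (this number does not depend on the sequence). $T(i)_j$ is the $\Bbbk$-vector space with basis $B(i)_j=\{b_{j,1},\dots,b_{j,d_j}\}$, and $B(i)=\bigcup_j B(i)_j$. For every arrow $\alpha:j\to k$ one has $|d_j-d_k|\le 1$, and $\phi_\alpha:T(i)_j\to T(i)_k$ is given by: - if $d_k=d_j+1$: $\phi_\alpha(b_{j,m})=b_{k,m}$ for all $m$; - if $d_k=d_j-1$: $\phi_\alpha(b_{j,m})=b_{k,m-1}$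 for $m\ge2$ and $\phi_\alpha(b_{j,1})=0$; - if $d_k=d_j$ and the position $(x,R)$ corresponding to $\alpha$ is a marker of the minimal Kauffman state: $\phi_\alpha(b_{j,m})=b_{k,m-1}$ for $m\ge2$ and $\phi_\alpha(b_{j,1})=0$ (nilpotent Jordan block); - if $d_k=d_j$ and $(x,R)$ is not a marker of the minimal Kauffman state: $\phi_\alpha(b_{j,m})=b_{k,m}$ for all $m$ (identity). Coefficient quiver. $\Gamma(T(i),B(i))$ has vertex set $B(i)$, and for each arrow $\alpha:j\to k$ of $Q$ there is an arrow $b\to b'$ (with $b\in B(i)_j$, $b'\in B(i)_k$) if and only if the coefficient of $b'$ in $\phi_\alpha(b)$ is nonzero. The poset of the coefficient quiver is the set $B(i)$ with $b'\le b$ if and only if there is a (possibly trivial) directed path from $b$ to $b'$ in $\Gamma(T(i),B(i))$. *)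

(* Defs.v *)
From HB Require Import structures.
From mathcomp Require Import all_boot all_order all_algebra all_fingroup.
From Stdlib Require Import ClassicalEpsilon Relation_Operators.

Set Implicit Arguments.
Unset Strict Implicit.
Unset Printing Implicit Defensive.

Import GRing.Theory.
Local Open Scope nat_scope.

(* Cells of a diagram are orbits of permutations of a finite set of darts. *)

Definition orbit_of (T : finType) (s : {perm T}) : finType :=
  {A : {set T} | A \in porbits s}.

Lemma porbit_in (T : finType) (s : {perm T}) (x : T) : porbit s x \in porbits s.
Proof. exact: imset_f. Qed.

Definition orb (T : finType) (s : {perm T}) (x : T) : orbit_of s :=
  exist _ (porbit s x) (porbit_in s x).

(* A link diagram on the oriented sphere, as a combinatorial map.  A dart is a
   half-segment, oriented away from its crossing point; [rot d] is the next dart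
   clockwise around the same crossing point, [flip d] is the other half of the
   same segment, and [over d] tells whether the strand of [d] is the upper one
   at its crossing point.  [circles] counts the link components without
   crossing points; these, and disconnected diagrams, are needed only to express
   Reidemeister moves.  Relative positions of the connected components of a
   diagram are not recorded: they do not affect the link.

   Right of a dart [d] lies the corner between [d] and [rot d].  Walking along
   [d] with a region on the right, one reaches the crossing point of [flip d]
   and continues along [rot^-1 (flip d)].  The regions are therefore the orbits
   of [flip * rot^-1] (products in [{perm _}] apply the left factor first), and
   the region of [d] is the one on its right.  Planarity is Euler's formula
   V + F = E + 2 C, with C the number of connected components. *)
Record diagram := Diagram {
  dart : finType;
  rot : {perm dart};
  flip : {perm dart};
  over : pred dart;
  circles : nat;
  card_crossing : forall d, #|porbit rot d| = 4;
  flipK : involutive flip;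
  flip_neq : forall d, flip d != d;
  over_rot : forall d, over (rot d) = ~~ over d;
  euler : #|porbits rot| + #|porbits (flip * rot^-1)%g| =
    #|porbits flip| + (n_comp [rel d e | (e == rot d) || (e == flip d)] dart).*2
}.

Section Cells.
Variable K : diagram.

Definition next_side : {perm dart K} := (flip K * (rot K)^-1)%g.

Definition crossing : finType := orbit_of (rot K).
Definition segment : finType := orbit_of (flip K).
Definition region : finType := orbit_of next_side.

Definition cr (d : dart K) : crossing := orb (rot K) d.
Definition seg (d : dart K) : segment := orb (flip K) d.
Definition reg (d : dart K) : region := orb next_side d.

Definition opp (d : dart K) : dart K := rot K (rot K d).

(* K_0 is nonempty and the regions are discs: K is a cellular decomposition. *)
Definition cellular : Prop :=
  [/\ 0 < #|crossing|,
      n_comp [rel d e : dart K | (e == rot K d) || (e == flip K d)] (dart K) = 1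
    & circles K = 0].

Definition without_curls : Prop := forall R : region, #|val R| != 1.

(* A simple closed curve meeting K transversally in two points crosses the
   segment of [d] from the region [reg d] to [reg (flip d)] and comes back across
   the segment of [d'].  A function [side] tells on which of the two sides of
   the curve each crossing point lies: it changes along a segment exactly when
   the curve crosses that segment an odd number of times.  One of the two sides
   has no crossing point. *)
Definition prime_projection : Prop :=
  forall d d' : dart K, reg d = reg d' -> reg (flip K d) = reg (flip K d') ->
  forall side : crossing -> bool,
    (forall e, side (cr e) (+) side (cr (flip K e)) =
               (seg e == seg d) (+) (seg e == seg d')) ->
  exists b : bool, forall x, side x = b.

End Cells.

(* Links are diagrams up to Reidemeister moves. *)

Definition isomorphic (K L : diagram) : Prop :=
  exists h : dart L -> dart K,
    [/\ bijective h,
        forall d, h (rot L d) = rot K (h d),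
        forall d, h (flip L d) = flip K (h d),
        forall d, over (h d) = over d
      & circles L = circles K].

(* [straight] follows the link to the next segment; each component with
   crossing points gives two orbits, one for each direction of travel. *)
Definition straight (K : diagram) : {perm dart K} :=
  (flip K * rot K * rot K)%g.

Definition components (K : diagram) : nat :=
  (#|porbits (straight K)|)./2 + circles K.

(* [L] arises from [K] by erasing the crossing points whose darts form [X], the
   strands through them being joined straight ahead; a component all of whose
   crossing points are erased becomes a crossingless circle. *)
Definition erasure (K : diagram) (X : {set dart K}) (L : diagram) : Prop :=
  exists h : dart L -> dart K,
    [/\ injective h /\ (forall d, (d \in codom h) = (d \notin X)),
        forall d, h (rot L d) = rot K (h d),
        forall d, over (h d) = over d,
        forall d, exists n,
          h (flip L d) = iter n (fun e => flip K (opp e)) (flip K (h d)) /\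
          forall m, m < n ->
            iter m (fun e => flip K (opp e)) (flip K (h d)) \in X
      & components L = components K].

Definition reidemeister1 (K L : diagram) : Prop :=
  exists d : dart K,
    next_side K d = d /\ erasure (porbit (rot K) d) L.

(* A bigon with distinct corners, one of whose sides is over (or under) at both
   of its ends. *)
Definition reidemeister2 (K L : diagram) : Prop :=
  exists d : dart K,
    [/\ next_side K (next_side K d) = d,
        cr d != cr (flip K d),
        over d = over (flip K d)
      & erasure (porbit (rot K) d :|: porbit (rot K) (flip K d)) L].

(* Sliding a strand over a triangle keeps the crossing points and the cyclic
   orders around them, and along each of the three strands it exchanges the two
   crossing points of the triangle: the outer dart at one takes the place of the
   inner dart at the other. *)
Definition slide (K : diagram) (T : {set dart K}) (d : dart K) : dart K :=
  if (d \in T) || (flip K d \in T) then opp (flip K d)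
  else if (opp d \in T) || (flip K (opp d) \in T) then flip K (opp d)
  else d.

Definition reidemeister3 (K L : diagram) : Prop :=
  exists d : dart K,
    let T := porbit (next_side K) d in
    [/\ #|T| = 3, {in T &, injective (@cr K)},
        exists2 e, e \in T & over e = over (flip K e)
      & exists h : dart L -> dart K,
          [/\ bijective h,
              forall e, h (rot L e) = rot K (h e),
              forall e, h (flip L e) = slide T (flip K (slide T (h e))),
              forall e, over (h e) = over e
            & circles L = circles K]].

Definition move (K L : diagram) : Prop :=
  [\/ isomorphic K L, reidemeister1 K L, reidemeister2 K L
    | reidemeister3 K L].

Definition same_link : diagram -> diagram -> Prop :=
  clos_refl_sym_trans diagram move.

Definition trivial_link (K : diagram) : Prop :=
  exists2 L, same_link K L & #|dart L| = 0.

(* Both segments are cut, and the four ends are joined across. *)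
Definition connected_sum (K1 K2 : diagram) (a1 : dart K1) (a2 : dart K2)
    (K : diagram) : Prop :=
  exists h : dart K1 + dart K2 -> dart K,
    [/\ [/\ bijective h,
            forall d, h (inl (rot K1 d)) = rot K (h (inl d)) /\
                      over (h (inl d)) = over d
          & forall d, h (inr (rot K2 d)) = rot K (h (inr d)) /\
                      over (h (inr d)) = over d],
        flip K (h (inl a1)) = h (inr a2) /\
        flip K (h (inl (flip K1 a1))) = h (inr (flip K2 a2)),
        forall d, seg d != seg a1 ->
          flip K (h (inl d)) = h (inl (flip K1 d)),
        forall d, seg d != seg a2 ->
          flip K (h (inr d)) = h (inr (flip K2 d))
      & circles K = circles K1 + circles K2].

(* Up to a first Reidemeister move, the connected sum is along components with
   crossing points. *)
Definition prime_link (K : diagram) : Prop :=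
  ~ exists (K1 K2 L : diagram) (a1 : dart K1) (a2 : dart K2),
      [/\ ~ trivial_link K1, ~ trivial_link K2,
          connected_sum a1 a2 L & same_link K L].

Definition prime_diagram (K : diagram) : Prop :=
  prime_link K /\ prime_projection K.

Section KauffmanStates.
Variables (K : diagram) (i : segment K).

Definition marker : finType := (crossing K * region K)%type.

Definition incident (x : crossing K) (R : region K) : bool :=
  [exists d, (cr d == x) && (reg d == R)].

Definition adjacent (j : segment K) (R : region K) : bool :=
  [exists d, (seg d == j) && (reg d == R)].

Definition is_state (S : {set marker}) : bool :=
  [&& [forall m in S, incident m.1 m.2],
      [forall x, #|[set m in S | m.1 == x]| == 1]
    & [forall R, #|[set m in S | m.2 == R]| == ~~ adjacent i R]].

Definition state : finType := {S : {set marker} | is_state S}.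

(* With [x = cr d] and [y = cr (flip d)], going clockwise around [x] across the
   segment of [d] leads from [R1 = reg (flip d)] to [R2 = reg d]. *)
Definition ccw_transposition (j : segment K) (S S' : state) : bool :=
  [exists d, let: (x, y) := (cr d, cr (flip K d)) in
             let: (R1, R2) := (reg (flip K d), reg d) in
    [&& seg d == j,
        (x, R2) \in val S, (y, R1) \in val S,
        (x, R1) \in val S', (y, R2) \in val S'
      & val S :\: [set (x, R2); (y, R1)] == val S' :\: [set (x, R1); (y, R2)]]].

Definition ccw_step : rel state :=
  [rel S S' | [exists j, ccw_transposition j S S']].

Definition state_lt (S S' : state) : bool :=
  [exists S1, ccw_step S S1 && connect ccw_step S1 S'].

Definition state_le (S S' : state) : bool := (S == S') || state_lt S S'.

Definition minimal_state (S : state) : bool := [forall S', ~~ state_lt S' S].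
Definition maximal_state (S : state) : bool := [forall S', ~~ state_lt S S'].

Definition is_join (a b c : state) : bool :=
  [&& state_le a c, state_le b c
    & [forall u, state_le a u && state_le b u ==> state_le c u]].

Definition join_irreducible (c : state) : bool :=
  ~~ [forall a, state_le c a] &&
  [forall a, forall b, is_join a b c ==> (c == a) || (c == b)].

(* The list records, for each transposition, its segment and its result. *)
Fixpoint transposition_seq (S : state) (w : seq (segment K * state))
    (S' : state) : bool :=
  if w is (j, S1) :: w1 then
    ccw_transposition j S S1 && transposition_seq S1 w1 S'
  else S == S'.

Definition transposition_count (j : segment K) (w : seq (segment K * state)) :
    nat :=
  count (fun p => p.1 == j) w.

(* [epsilon] selects the number of transpositions at [j]; it does not depend on
   the sequence [w]. *)
Definition state_dim (j : segment K) : nat :=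
  epsilon (inhabits 0) (fun n => exists (S0 S1 : state) w,
    [/\ minimal_state S0, maximal_state S1, transposition_seq S0 w S1
      & transposition_count j w = n]).

End KauffmanStates.

Record quiver := Quiver {
  vertex : finType;
  arrow : finType;
  source : arrow -> vertex;
  target : arrow -> vertex
}.

(* A representation with chosen bases.  The space at [j] is ['rV_(rep_dim j)]
   with its standard basis, and matrices act on row vectors from the right. *)
Record representation (k : fieldType) (Q : quiver) := Representation {
  rep_dim : vertex Q -> nat;
  rep_map : forall a : arrow Q,
    'M[k]_(rep_dim (source a), rep_dim (target a))
}.

Section CoefficientQuiver.
Variables (k : fieldType) (Q : quiver) (M : representation k Q).

Definition rep_basis : finType := {j : vertex Q & 'I_(rep_dim M j)}.

Definition basis_elt (j : vertex Q) (m : 'I_(rep_dim M j)) : rep_basis :=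
  Tagged (fun j => 'I_(rep_dim M j)) m.

Definition coef_arrow : rel rep_basis :=
  [rel b b' | [exists a : arrow Q,
     [exists m : 'I_(rep_dim M (source a)),
     [exists m' : 'I_(rep_dim M (target a)),
       [&& b == basis_elt m, b' == basis_elt m'
         & ((delta_mx 0 m : 'rV[k]_(rep_dim M (source a))) *m rep_map M a)%R
             0%R m' != 0%R]]]]].

Definition coef_le (b' b : rep_basis) : bool := connect coef_arrow b b'.

End CoefficientQuiver.

Section TheRepresentation.
Variables (K : diagram) (i : segment K).

(* The dart [d] gives the arrow from [seg d] to [seg (rot d)], at the position
   [(cr d, reg d)].  In a prime diagram without curls no two arrows are
   parallel (their segments would border the same two regions), so cancelling
   2-cycles amounts to removing every arrow that lies in one. *)
Definition in_2cycle (d : dart K) : bool :=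
  [exists e, (seg e == seg (rot K d)) && (seg (rot K e) == seg d)].

Definition diagram_quiver : quiver :=
  @Quiver (segment K) {d : dart K | ~~ in_2cycle d}
    (fun a => seg (val a)) (fun a => seg (rot K (val a))).

Definition in_minimal_state (m : marker K) : bool :=
  [exists S : state i, minimal_state S && (m \in val S)].

(* Entry (m, m') is the coefficient of the m'-th basis vector of the target in
   the image of the m-th one of the source.  The last case does not occur, as
   the dimensions differ by at most 1. *)
Definition arrow_matrix (k : fieldType) (a : arrow diagram_quiver) :
    'M[k]_(state_dim i (source a), state_dim i (target a)) :=
  let dj := state_dim i (source a) in
  let dk := state_dim i (target a) in
  let d := val a : dart K in
  \matrix_(m, m')
    if dk == dj.+1 then ((m' == m :> nat)%:R)%R
    else if dj == dk.+1 then ((m'.+1 == m :> nat)%:R)%R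
    else if dj == dk then
      if in_minimal_state (cr d, reg d) then ((m'.+1 == m :> nat)%:R)%R
      else ((m' == m :> nat)%:R)%R
    else 0%R.

Definition link_rep (k : fieldType) : representation k diagram_quiver :=
  @Representation k diagram_quiver (state_dim i) (arrow_matrix k).

End TheRepresentation.

(* Main.v *)
Require Import Defs.
From mathcomp Require Import all_boot all_order all_algebra all_fingroup.
From mathcomp Require Import zify.
From Stdlib Require Import ClassicalEpsilon.

(* A prime diagram without curls has four distinct regions at each crossing
   point and no two segments between the same pair of regions, so a state is a
   set of darts (corners).  By Euler's formula two states differ by the
   coboundary of a unique height function on the segments that vanishes at [i],
   and conversely every function with the right increments along the corners is
   the height of a state.  These functions are closed under pointwise minimum
   and maximum, and a transposition at [j] raises the height at [j] by one.
   That states comparable in height are joined by transpositions follows from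
   Hall's theorem: fewer than n regions have all their corners at crossing points
   of a given nonempty proper set of size n, hence every corner away from [i] is a
   marker of some state, and among the segments whose height has to grow, the one
   where the sum of the heights of all states is largest can be transposed.

   With heights measured from the minimal state, the height of the maximal state
   is the dimension vector, and the join irreducible states are the least states
   of height at least m at [j]; they correspond to the basis elements.  An arrow of
   the quiver lowers the level m by one or zero according to whether its
   position is a marker of the minimal state, which is the worst possible
   decrease of heights along that corner.  Hence the elements reachable from a
   given one form the height function of a state, and reachability is the order.
   An arrow removed in a 2-cycle belongs to a bigon, and is the composite of the
   three other arrows at the other crossing point of the bigon. *)

Set Implicit Arguments.
Unset Strict Implicit.
Unset Printing Implicit Defensive.

Import Order.TTheory GRing.Theory Num.Theory.

(** * Ranks and exactness of three-term complexes *)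

Section LinearAlgebra.
Local Open Scope ring_scope.
Variable k : fieldType.

(** The left kernel lies in the line spanned by the all-ones row, so its dimension is at most
    one. *)
Lemma corank_le1 m n (A : 'M[k]_(m, n)) :
    (forall u : 'rV_m, u *m A = 0 -> forall i i', u 0 i = u 0 i') ->
  (m <= (\rank A).+1)%N.
Proof.
move=> kerA; have: (\rank (kermx A) <= 1)%N.
  apply: leq_trans (rank_leq_row (const_mx 1 : 'rV[k]_m)).
  apply: mxrankS; apply/row_subP => i.
  have /kerA cst : row i (kermx A) *m A = 0 by rewrite -row_mul mulmx_ker row0.
  have -> : row i (kermx A) = (row i (kermx A) 0 i) *: (const_mx 1 : 'rV[k]_m).
    by apply/rowP => j; rewrite [LHS](cst j i) !mxE mulr1.
  exact: scalemx_sub.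
by rewrite mxrank_ker; lia.
Qed.

Variables I J L : finType.
Variables (a : I -> J -> k) (b : J -> L -> k).
Hypothesis ab0 : forall i l, \sum_j a i j * b j l = 0.
Hypothesis ker_a : forall u : I -> k,
  (forall j, \sum_i u i * a i j = 0) -> forall i i', u i = u i'.

Let sum_enum (T : finType) (F : T -> k) :
  \sum_x F x = \sum_(i < #|T|) F (enum_val i).
Proof. by rewrite (reindex (@enum_val T T)) //; apply: onW_bij (enum_val_bij _). Qed.

Let mx_of (S T : finType) (c : S -> T -> k) : 'M[k]_(#|S|, #|T|) :=
  \matrix_(s, t) c (enum_val s) (enum_val t).

Let mx_of0 : mx_of a *m mx_of b = 0.
Proof.
apply/matrixP => i l; rewrite !mxE -[RHS](ab0 (enum_val i) (enum_val l)).
rewrite [RHS]sum_enum.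
by apply: eq_bigr => j _; rewrite !mxE.
Qed.

Let rank_a : (#|I| <= (\rank (mx_of a)).+1)%N.
Proof.
apply: corank_le1 => u uA0 i i'.
pose v x := u 0 (enum_rank x); rewrite -(enum_valK i) -(enum_valK i').
apply: (ker_a (u := v)) => j; move/rowP/(_ (enum_rank j)): uA0; rewrite !mxE; apply: etrans.
by rewrite sum_enum; apply: eq_bigr => x _; rewrite /v !mxE enum_valK enum_rankK.
Qed.

Let ker_b (v : 'rV_#|L|) : v *m (mx_of b)^T = 0 ->
  forall j, \sum_l b j l * v 0 (enum_rank l) = 0.
Proof.
move=> vB0 j; move/rowP/(_ (enum_rank j)): vB0; rewrite !mxE; apply: etrans.
by rewrite sum_enum; apply: eq_bigr => x _; rewrite !mxE enum_valK enum_rankK mulrC.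
Qed.

(** Since the composite vanishes, the two ranks add up to at most [#|J|]; the first is at least
    [#|I| - 1], and [b] has full column rank. *)
Lemma complex_card_le :
    (forall v : L -> k, (forall j, \sum_l b j l * v l = 0) -> forall l, v l = 0) ->
  (#|I| + #|L| <= #|J|.+1)%N.
Proof.
move=> ker0; have := mulmx0_rank_max mx_of0.
suff: \rank (mx_of b) = #|L| by move: rank_a; lia.
rewrite -mxrank_tr; apply/eqP; rewrite -[_ == _]/(row_free _) -kermx_eq0.
apply/eqP/row_matrixP => l; rewrite row0; apply/rowP => j; rewrite [RHS]mxE.
rewrite -(enum_valK j).
apply: (ker0 (fun x => row l (kermx (mx_of b)^T) 0 (enum_rank x))).
by apply: ker_b; rewrite -row_mul mulmx_ker row0.
Qed.

(** Each rank falls short of its maximum by at most one, and Euler characteristic two makes the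
    ranks add up to [#|J|], so the row space of [a] fills the kernel of [b]. This yields the
    vanishing of the first cohomology of the sphere. *)
Lemma complex_exact :
    (forall v : L -> k, (forall j, \sum_l b j l * v l = 0) ->
       forall l l', v l = v l') ->
    (#|I| + #|L| = #|J| + 2)%N ->
  forall w : J -> k, (forall l, \sum_j w j * b j l = 0) ->
  exists u : I -> k, forall j, w j = \sum_i u i * a i j.
Proof.
move=> kerc card w wb0.
have rank_b : (#|L| <= (\rank (mx_of b)).+1)%N.
  rewrite -mxrank_tr; apply: corank_le1 => v /ker_b vb0 l l'.
  rewrite -(enum_valK l) -(enum_valK l').
  exact: (kerc (fun x => v 0 (enum_rank x))).
have sub : (mx_of a <= kermx (mx_of b))%MS by apply/sub_kermxP.
have eqs : (kermx (mx_of b) <= mx_of a)%MS.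
  rewrite -(mxrank_leqif_sup sub) eqn_leq mxrankS // mxrank_ker.
  by move: rank_a rank_b card; lia.
have : (\row_j w (enum_val j) <= mx_of a)%MS.
  apply: submx_trans eqs; apply/sub_kermxP/rowP => l; rewrite !mxE.
  rewrite -[RHS](wb0 (enum_val l)) [RHS]sum_enum.
  by apply: eq_bigr => j _; rewrite !mxE.
case/submxP => u wE; exists (fun x => u 0 (enum_rank x)) => j.
move/rowP/(_ (enum_rank j)): wE; rewrite !mxE enum_rankK => ->.
rewrite [RHS]sum_enum.
by apply: eq_bigr => x _; rewrite !mxE enum_valK enum_rankK.
Qed.

End LinearAlgebra.

(** Passage to subtypes, with functions extended by zero; it serves for the part of a diagram
    spanned by some crossing points. *)
Lemma complex_card_le_in (k : fieldType) (I J L : finType)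
    (a : I -> J -> k) (b : J -> L -> k) (A : {set I}) (B : {set J}) (C : {set L}) :
    (forall i l, i \in A -> l \in C -> \sum_(j in B) a i j * b j l = 0)%R ->
    (forall u : I -> k, (forall j, j \in B -> \sum_(i in A) u i * a i j = 0)%R ->
       {in A &, forall i i', u i = u i'}) ->
    (forall v : L -> k, (forall j, j \in B -> \sum_(l in C) b j l * v l = 0)%R ->
       {in C, forall l, v l = 0%R}) ->
  #|A| + #|C| <= #|B|.+1.
Proof.
move=> ab0 ker_a ker_b; pose ext (T : finType) (D : {set T}) (u : {x | x \in D} -> k) x :=
  oapp u 0%R (insub x).
have extE (T : finType) (D : {set T}) (u : {x | x \in D} -> k) x : ext T D u (val x) = u x.
  by rewrite /ext valK.
have := @complex_card_le k {i | i \in A} {j | j \in B} {l | l \in C}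
  (fun i j => a (val i) (val j)) (fun j l => b (val j) (val l)).
rewrite !card_sig; apply.
- by move=> i l; rewrite -[RHS](ab0 _ _ (valP i) (valP l)) [RHS]big_sub.
- move=> u u0 i i'; rewrite -!extE; apply: ker_a; [move=> j jB | exact: valP..].
  rewrite -[RHS](u0 (Sub j jB)) [LHS]big_sub.
  by apply: eq_bigr => x _; rewrite extE.
move=> v v0 l; rewrite -extE; apply: ker_b; [move=> j jB | exact: valP].
rewrite -[RHS](v0 (Sub j jB)) [LHS]big_sub.
by apply: eq_bigr => x _; rewrite extE.
Qed.

(** * Hall's marriage theorem *)

Section Hall.
Variables A B : finType.

(* Rado's proof: remove elements from the sets [N a] as long as Hall's
   condition permits; by submodularity it stops at singletons. *)
Lemma hall_marriage (N : A -> {set B}) :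
    (forall X : {set A}, #|X| <= #|\bigcup_(x in X) N x|) ->
  exists2 g : A -> B, injective g & forall x, g x \in N x.
Proof.
have [n] := ubnP (\sum_x #|N x|); elim: n => // n IHn in N *.
rewrite ltnS => leNn hallN.
have cardN x : 0 < #|N x|.
  by have := hallN [set x]; rewrite cards1 big_set1.
have [/existsP[x Nx2] | /existsPn small] := boolP [exists x, 1 < #|N x|].
  have [b1 [b2 [b1N b2N b12]]] := card_gt1P Nx2.
  pose N' b y := if y == x then N y :\ b else N y.
  have step b : b \in N x -> (exists2 g : A -> B, injective g & forall x, g x \in N x) \/
      exists2 X : {set A}, x \in X & #|\bigcup_(y in X) N' b y| < #|X|.
    move=> bN; have [hallN'|] := boolP [forall X : {set A}, #|X| <= #|\bigcup_(y in X) N' b y|].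
      left; have [||g g_inj gN'] := IHn (N' b).
      - apply: leq_trans leNn; rewrite (bigD1 x) //= [in leqRHS](bigD1 x) //= {1}/N' eqxx.
        rewrite (cardsD1 b (N x)) bN -addnA add1n ltnS leq_add2l leq_sum // => y /negPf nyx.
        by rewrite /N' nyx.
      - by move=> X; apply: (forallP hallN').
      exists g => // y; have := gN' y; rewrite /N'; case: ifP => // _.
      by case/setD1P.
    case/forallPn => X; rewrite -ltnNge => ltX; right; exists X => //.
    apply: contraLR ltX => nxX; rewrite -leqNgt.
    suff -> : \bigcup_(y in X) N' b y = \bigcup_(y in X) N y by apply: hallN.
    apply: eq_bigr => y yX; rewrite /N'; case: eqP yX nxX => // -> ->//.
  (* If neither [b1] nor [b2] can be removed, the violating sets [X1] and [X2] both contain [x]. As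
     [b1] and [b2] differ, the two reduced unions together still cover [N x], and Hall's condition
     for [X1 :|: X2] and for [(X1 :&: X2) :\ x] gives a contradiction. *)
  case: (step _ b1N) => // -[X1 xX1 lt1]; case: (step _ b2N) => // -[X2 xX2 lt2].
  have := cardsUI X1 X2; have := cardsUI (\bigcup_(y in X1) N' b1 y) (\bigcup_(y in X2) N' b2 y).
  have : #|\bigcup_(y in X1 :|: X2) N y| <=
      #|\bigcup_(y in X1) N' b1 y :|: \bigcup_(y in X2) N' b2 y|.
    apply/subset_leq_card/bigcupsP => y yX; apply/subsetP => c cN.
    have [yx|nyx] := eqVneq y x.
      have [cb1|ncb1] := eqVneq c b1.
        by apply/setUP; right; apply/bigcupP; exists x; rewrite // /N' eqxx !inE cb1 b12.
      by apply/setUP; left; apply/bigcupP; exists x; rewrite // /N' eqxx !inE ncb1 -yx.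
    apply/setUP; case/setUP: yX => yX; [left|right]; apply/bigcupP; exists y => //;
      by rewrite /N' (negPf nyx).
  have : #|\bigcup_(y in (X1 :&: X2) :\ x) N y| <=
      #|\bigcup_(y in X1) N' b1 y :&: \bigcup_(y in X2) N' b2 y|.
    apply/subset_leq_card/bigcupsP => y /setD1P[nyx /setIP[y1 y2]]; apply/subsetP => c cN.
    by apply/setIP; split; apply/bigcupP; exists y; rewrite // /N' (negPf nyx).
  have := hallN (X1 :|: X2); have := hallN ((X1 :&: X2) :\ x).
  have := cardsD1 x (X1 :&: X2); rewrite inE xX1 xX2 /=.
  by move: lt1 lt2; lia.
have choose x : exists b, b \in N x by apply/card_gt0P.
pose g x := xchoose (choose x).
have gN x : g x \in N x := xchooseP (choose x).
exists g => // x y gxy; apply: contraTeq isT => nxy.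
have := hallN [set x; y]; rewrite cards2 nxy /= bigcup_setU !big_set1.
suff : #|N x :|: N y| <= 1 by lia.
have Ng z : N z = [set g z].
  apply/eqP; rewrite eq_sym eqEcard sub1set gN cards1 /=.
  by have := small z; lia.
by rewrite (Ng x) (Ng y) gxy setUid cards1.
Qed.

End Hall.

(** * Join irreducibles in a finite lattice of height functions *)

Section HeightLattice.
Variables (St J : finType) (H : St -> J -> nat).

Definition hle (S S' : St) := [forall j, H S j <= H S' j].

Definition least_at (c : St) (j : J) (m : nat) :=
  m <= H c j /\ forall S, m <= H S j -> hle c S.

Definition hjoin (a b c : St) :=
  [/\ hle a c, hle b c & forall u, hle a u -> hle b u -> hle c u].

Hypothesis H_inj : forall S S', H S =1 H S' -> S = S'.
Hypothesis H_min : forall S S', exists T, forall j, H T j = minn (H S j) (H S' j).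
Hypothesis H_max : forall S S', exists T, forall j, H T j = maxn (H S j) (H S' j).
Hypothesis H_bot : exists S, forall j, H S j = 0.
Hypothesis H_step : forall S S', hle S S' -> S != S' ->
  exists j T, (forall k, H T k = H S k + (k == j)) /\ hle T S'.

Lemma hle_refl S : hle S S.
Proof. exact/forallP. Qed.

Lemma hle_trans S T U : hle S T -> hle T U -> hle S U.
Proof. by move=> /forallP ST /forallP TU; apply/forallP => j; apply: leq_trans (TU j). Qed.

Lemma hle_anti S T : hle S T -> hle T S -> S = T.
Proof.
by move=> /forallP ST /forallP TS; apply: H_inj => j; apply/eqP; rewrite eqn_leq ST TS.
Qed.

Lemma sum_height_lt S T : hle S T -> S != T -> \sum_j H S j < \sum_j H T j.
Proof.
move=> /forallP ST nST; rewrite ltn_neqAle leq_sum // andbT.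
apply: contraNneq nST => /eqP; rewrite (leqif_sum (fun j _ => leqif_eq (ST j))).
by move=> /forallP eqST; apply/eqP/H_inj => j; apply/eqP/eqST.
Qed.

(** Dual of [H_step]: upward steps from [S] end in [S'], and the last of them is the required
    one. *)
Lemma down_step S S' : hle S S' -> S != S' ->
  exists j T, hle S T /\ forall k, H S' k = H T k + (k == j).
Proof.
have [n] := ubnP (\sum_j H S' j - \sum_j H S j); elim: n S => // n IHn S.
rewrite ltnS => len leSS' nSS'; have [j [T [TE leTS']]] := H_step leSS' nSS'.
have leST : hle S T by apply/forallP => k; rewrite TE leq_addr.
have [eqT | nT] := eqVneq T S'; first by exists j, S; split; rewrite ?hle_refl // -eqT.
have [|||l [U [leTU UE]]] := IHn T => //; last first.
  by exists l, U; split=> //; apply: hle_trans leTU.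
have ltST : \sum_k H S k < \sum_k H T k.
  apply: sum_height_lt => //; apply/eqP => eqST; have := TE j; rewrite -eqST eqxx; lia.
by have := sum_height_lt leTS' nT; move: len; lia.
Qed.

(** A candidate of minimal total height is least, since its minimum with any other candidate is
    again a candidate. *)
Lemma least_at_exists S j m : m <= H S j -> exists c, least_at c j m.
Proof.
move=> mS; pose c := [arg min_(T < S | m <= H T j) \sum_k H T k].
have [mc minc] : m <= H c j /\ forall T, m <= H T j -> \sum_k H c k <= \sum_k H T k.
  by rewrite /c; case: arg_minnP.
exists c; split=> // T mT; have [U UE] := H_min c T.
have leUc : hle U c by apply/forallP => k; rewrite UE geq_minl.
have [<-|nUc] := eqVneq U c; first by apply/forallP => k; rewrite UE geq_minr.
have := minc U; rewrite UE leq_min mc mT => /(_ isT).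
by rewrite leqNgt sum_height_lt.
Qed.

Lemma bot_least S0 S : (forall j, H S0 j = 0) -> hle S0 S.
Proof. by move=> S00; apply/forallP => j; rewrite S00. Qed.

(** A step down from [c] at a segment other than [j] would keep the height at [j], against
    leastness. *)
Lemma least_at_pred c j m : least_at c j m.+1 ->
  exists T, hle T c /\ forall k, H c k = H T k + (k == j).
Proof.
move=> [mc minc]; have [S0 S00] := H_bot.
have [|l [T [_ TE]]] := down_step (bot_least c S00).
  by apply: contraTneq mc => <-; rewrite S00.
have leTc : hle T c by apply/forallP => k; rewrite TE leq_addr.
exists T; split=> //; suff -> : j = l by [].
apply: contraTeq isT => njl; suff /minc/forallP/(_ l) : m.+1 <= H T j by rewrite TE eqxx; lia.
by move: mc; rewrite TE (negPf njl) addn0.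
Qed.

Lemma least_at_height c j m : least_at c j m.+1 -> H c j = m.+1.
Proof.
move=> lc; have [T [leTc TE]] := least_at_pred lc; case: (lc) => mc minc.
apply/eqP; rewrite eqn_leq mc andbT leqNgt; apply/negP => ltc.
have /minc/forallP/(_ j) : m.+1 <= H T j by move: ltc; rewrite TE eqxx; lia.
by rewrite TE eqxx; lia.
Qed.

(** The step down from [c] at [j] keeps the height at every other [k], so [c] cannot also be least
    at [k]. *)
Lemma least_at_inj c j m k n : least_at c j m.+1 -> least_at c k n.+1 -> j = k /\ m = n.
Proof.
move=> lj lk; suff jk : j = k.
  split=> //; apply/eqP; rewrite -eqSS -(least_at_height lj) -(least_at_height lk) jk.
  exact: eqxx.
have [T [leTc TE]] := least_at_pred lj; case: lk => nc minc.
apply: contraTeq isT => njk; suff /minc/forallP/(_ j) : n.+1 <= H T k by rewrite TE eqxx; lia.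
by move: nc; rewrite TE eq_sym (negPf njk) addn0.
Qed.

(** If [c] covers [T] by a step at [j], then [c] is the join of [T] and the least element whose
    height at [j] exceeds that of [T]; irreducibility identifies [c] with the latter. Conversely, a
    pointwise maximum reaches a given height at [j] only if one of its two arguments does. *)
Lemma join_irreducible_least c :
  (~ (forall a, hle c a) /\ forall a b, hjoin a b c -> c = a \/ c = b) <->
  exists j m, least_at c j m.+1.
Proof.
split=> [[nbot irr] | [j [m lc]]].
  have [S0 S00] := H_bot.
  have [|j [T [_ TE]]] := down_step (bot_least c S00).
    by apply/eqP => eqc; apply: nbot => a; rewrite -eqc; apply: bot_least.
  have [|a la] := @least_at_exists c j (H T j).+1; first by rewrite TE eqxx addn1.
  exists j, (H T j); have [|eqT|-> //] := irr T a; last first.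
    by have := TE j; rewrite eqT eqxx; lia.
  case: (la) => _ mina; split=> [||u /forallP Tu /forallP au].
  - by apply/forallP => k; rewrite TE leq_addr.
  - by apply: mina; rewrite TE eqxx addn1.
  apply/forallP => k; rewrite TE; have [->|_] := eqVneq; last by rewrite addn0.
  by have := au j; rewrite (least_at_height la) addn1.
have hc := least_at_height lc; case: (lc) => mc minc; split=> [bot | a b [ac bc cmin]].
  have [S0 S00] := H_bot; have /forallP/(_ j) := bot S0; by rewrite S00 hc.
have [T TE] := H_max a b.
have /forallP/(_ j) : hle c T.
  by apply: cmin; apply/forallP => k; rewrite TE leq_max leqnn ?orbT.
rewrite TE hc leq_max => /orP[]/minc le; [left|right]; exact: hle_anti.
Qed.

End HeightLattice.

(** * Darts, cells and their numbers *)

Section Darts.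
Variable K : diagram.
Local Notation r := (Defs.rot K).
Local Notation f := (flip K).

Lemma rot4 d : r (r (r (r d))) = d.
Proof. by have := iter_porbit r d; rewrite card_crossing. Qed.

Lemma porbit_rot d : porbit r d =i [:: d; r d; r (r d); r (r (r d))].
Proof.
move=> e; rewrite porbit_traject card_crossing /= !inE //.
Qed.

Lemma rot_orbit_uniq d : uniq [:: d; r d; r (r d); r (r (r d))].
Proof. by have := uniq_traject_porbit r d; rewrite card_crossing. Qed.

Lemma porbit_flip d : porbit f d =i [:: d; f d].
Proof.
move=> e; apply/porbitP/idP => [[n ->]|].
  elim: n => [|n]; first by rewrite expg0 perm1 inE eqxx.
  by rewrite expgSr permM !inE => /orP[]/eqP->; rewrite ?flipK eqxx ?orbT.
rewrite !inE => /orP[]/eqP->; first by exists 0; rewrite expg0 perm1.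
by exists 1; rewrite expg1.
Qed.

Lemma orbE (T : finType) (s : {perm T}) x y : (orb s x == orb s y) = (x \in porbit s y).
Proof. by rewrite -val_eqE /= eq_porbit_mem. Qed.

Lemma orb_perm (T : finType) (s : {perm T}) x : orb s (s x) = orb s x.
Proof. by apply/eqP; rewrite orbE; apply: (mem_porbit s 1). Qed.

Lemma orb_surj (T : finType) (s : {perm T}) (A : orbit_of s) : exists x, A = orb s x.
Proof. by case: A => A AP; have /imsetP[x _ Ax] := AP; exists x; apply: val_inj. Qed.

Lemma segE d e : (seg d == seg e) = (d == e) || (d == f e).
Proof. by rewrite orbE porbit_flip !inE. Qed.

Lemma crE d e : (cr d == cr e) = [|| d == e, d == r e, d == r (r e) | d == r (r (r e))].
Proof. by rewrite orbE porbit_rot !inE. Qed.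

Lemma seg_flip d : seg (f d) = seg d. Proof. exact: orb_perm. Qed.

Lemma cr_rot d : cr (r d) = cr d. Proof. exact: orb_perm. Qed.

Lemma next_sideE d : next_side K d = (r^-1)%g (f d).
Proof. by rewrite permM. Qed.

Lemma rot_next d : r (next_side K d) = f d.
Proof. by rewrite next_sideE permKV. Qed.

Lemma next_flip_rot d : next_side K (f (r d)) = d.
Proof. by rewrite next_sideE flipK permK. Qed.

Lemma reg_next d : reg (next_side K d) = reg d. Proof. exact: orb_perm. Qed.

(** The corner of [d] lies between [d] and [rot d], hence on the left of [rot d]. *)
Lemma reg_flip_rot d : reg (f (r d)) = reg d.
Proof. by rewrite -reg_next next_flip_rot. Qed.

Lemma cr_next d : cr (next_side K d) = cr (f d).
Proof. by rewrite -cr_rot rot_next. Qed.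

Lemma cr_surj (x : crossing K) : exists d, x = cr d. Proof. exact: orb_surj. Qed.
Lemma seg_surj (j : segment K) : exists d, j = seg d. Proof. exact: orb_surj. Qed.
Lemma reg_surj (R : region K) : exists d, R = reg d. Proof. exact: orb_surj. Qed.

Lemma reg_invariant (P : pred (dart K)) d :
    (forall e, reg e = reg d -> P e -> P (next_side K e)) ->
  P d -> forall e, reg e = reg d -> P e.
Proof.
move=> stab Pd e /eqP; rewrite orbE => /porbitP[n ->].
suff [] : P ((next_side K ^+ n)%g d) /\ reg ((next_side K ^+ n)%g d) = reg d by [].
elim: n => [|n [IHP IHr]]; first by rewrite expg0 perm1.
by rewrite expgSr permM reg_next; split=> //; apply: stab.
Qed.

Lemma sum_seg (V : nmodType) (F : dart K -> V) d :
  (\sum_(e | seg e == seg d) F e = F d + F (f d))%R.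
Proof.
rewrite (bigD1 d) //= (bigD1 (f d)) /=; last by rewrite seg_flip eqxx flip_neq.
rewrite big1 ?addr0 // => e /andP[/andP[]]; rewrite segE.
by move=> /orP[]/eqP->; rewrite eqxx.
Qed.

Lemma sum_cr (V : nmodType) (F : dart K -> V) d :
  (\sum_(e | cr e == cr d) F e = F d + F (r d) + F (r (r d)) + F (r (r (r d))))%R.
Proof.
rewrite (eq_bigl (mem [:: d; r d; r (r d); r (r (r d))])); last first.
  by move=> e; rewrite crE !inE.
by rewrite -big_uniq ?rot_orbit_uniq //= !big_cons big_nil addr0 !addrA.
Qed.

Lemma card_orbit_of (T : finType) (s : {perm T}) : #|{: orbit_of s}| = #|porbits s|.
Proof. by rewrite card_sig. Qed.

Lemma card_sum_fibers (T J : finType) (p : T -> J) (A : {pred T}) :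
  #|A| = \sum_j #|[pred e in A | p e == j]|.
Proof.
rewrite -sum1_card (partition_big p xpredT) //=.
by apply: eq_bigr => j _; rewrite sum1_card; apply: eq_card => e; rewrite !inE.
Qed.

Lemma card_dart_seg : #|dart K| = #|segment K| * 2.
Proof.
rewrite (card_sum_fibers (@seg K)) -sum_nat_const; apply: eq_bigr => j _.
have [d ->] := seg_surj j; rewrite -sum1_card (eq_bigl (fun e => seg e == seg d)) //.
by rewrite (@sum_seg nat).
Qed.

Lemma card_dart_cr : #|dart K| = #|crossing K| * 4.
Proof.
rewrite (card_sum_fibers (@cr K)) -sum_nat_const; apply: eq_bigr => x _.
have [d ->] := cr_surj x; rewrite -sum1_card (eq_bigl (fun e => cr e == cr d)) //.
by rewrite (@sum_cr nat).
Qed.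

Lemma card_crossing_seg : #|segment K| = #|crossing K| * 2.
Proof. by have := card_dart_seg; have := card_dart_cr; lia. Qed.

End Darts.

(** Here [b] and [c] tell whether the position is a marker of the minimal and of the maximal state.
    The cases defining the map then collapse into one: the index drops by [b]. *)
Lemma matrix_entry_neq0 (k : fieldType) (dj dk m m' : nat) (b c : bool) :
    dk + b = dj + c ->
  ((if dk == dj.+1 then (m' == m)%:R
    else if dj == dk.+1 then (m'.+1 == m)%:R
    else if dj == dk then if b then (m'.+1 == m)%:R else (m' == m)%:R
    else 0 : k) != 0)%R = (m == m' + b).
Proof.
have natr_neq0 (e : bool) : (e%:R != 0 :> k)%R = e by case: e; rewrite ?oner_eq0 ?eqxx.
have neqS n : (n == n.+1) = false by rewrite eqn_leq ltnn andbF.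
case: b c => [] []; rewrite ?addn0 ?addn1.
- by move=> [->]; rewrite neqS eqxx natr_neq0 eq_sym.
- by move=> <-; rewrite [dk == _]ltn_eqF // eqxx natr_neq0 eq_sym.
- by move=> ->; rewrite eqxx natr_neq0 eq_sym.
by move=> ->; rewrite neqS eqxx natr_neq0 eq_sym.
Qed.

(** * Arithmetic modulo 2 *)

Section F2.
Local Open Scope ring_scope.

Lemma F2_addxx (x : 'F_2) : x + x = 0.
Proof. by case: x => [[|[|n]]] // p; apply: val_inj. Qed.

Lemma F2_eq (x y : 'F_2) : x + y = 0 -> x = y.
Proof. by move=> /(congr1 (+%R^~ y)); rewrite -addrA F2_addxx addr0 add0r. Qed.

Lemma F2_neq0D (x y : 'F_2) : (x + y != 0) = (x != 0) (+) (y != 0).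
Proof. by case: x y => [[|[|n]] p] [[|[|m]] q]. Qed.

Lemma F2_neq0_natD (b c : bool) : ((b%:R + c%:R : 'F_2) != 0) = b (+) c.
Proof. by case: b c => [] []. Qed.

End F2.

(** * Connectedness and the cohomology of the sphere modulo 2 *)

Section Diagram.
Variable K : diagram.
Hypothesis K_cell : cellular K.
Local Notation r := (Defs.rot K).
Local Notation f := (flip K).

Lemma dart_invariant (T : Type) (phi : dart K -> T) :
    (forall d, phi (r d) = phi d) -> (forall d, phi (f d) = phi d) ->
  forall d e, phi d = phi e.
Proof.
move=> phi_r phi_f d e; pose E := [rel d e : dart K | (e == r d) || (e == f d)].
have phi_con x y : connect E x y -> phi x = phi y.
  case/connectP => p; elim: p x => [|z p IHp] x /=; first by move=> _ ->.
  by move=> /andP[/orP[]/eqP-> pth] /(IHp _ pth) <-.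
have [_ ncomp _] := K_cell.
have conS : connect_sym E.
  suff con_inv x y : connect E x y -> connect E y x by move=> x y; apply/idP/idP; apply: con_inv.
  case/connectP => p; elim: p x => [|z p IHp] x /=; first by move=> _ ->.
  move=> /andP[Exz pth] /(IHp _ pth) /connect_trans; apply.
  case/orP: Exz => /eqP ->; last by apply: connect1; rewrite /= flipK eqxx orbT.
  have con_r u : connect E u (r u) by apply: connect1; rewrite /= eqxx.
  (* The inverse of a rotation is three rotations, which makes the relation symmetric. *)
  by rewrite -{2}(rot4 x); do 2!apply: connect_trans (con_r _) _; apply: con_r.
have rootE x y : fingraph.root E x = fingraph.root E y.
  have /card_le1_eqP rootE : n_comp E (dart K) <= 1 by rewrite ncomp.
  by apply: rootE; rewrite !inE roots_root.
by rewrite (phi_con _ _ (connect_root E d)) (rootE d e) -(phi_con _ _ (connect_root E e)).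
Qed.

Lemma card_region : #|crossing K| + #|region K| = #|segment K| + 2.
Proof.
have [_ ncomp _] := K_cell; have := euler K; rewrite ncomp.
by rewrite !card_orbit_of.
Qed.

Lemma sum_by_seg (V : pzSemiRingType) (w : segment K -> V) (g : dart K -> V) :
  (\sum_j w j * (\sum_(d | seg d == j) g d) = \sum_d w (seg d) * g d)%R.
Proof.
rewrite [RHS](partition_big (@seg K) xpredT) //=; apply: eq_bigr => j _.
by rewrite mulr_sumr; apply: eq_bigr => d /eqP->.
Qed.

Lemma sum_indicator (V : pzSemiRingType) (T J : finType) (p : T -> J) (w : J -> V) (P : pred T) :
  (\sum_j w j * (\sum_(d | P d) (p d == j)%:R) = \sum_(d | P d) w (p d))%R.
Proof.
under eq_bigr do rewrite mulr_sumr; rewrite exchange_big; apply: eq_bigr => d _ /=.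
rewrite (bigD1 (p d)) //= eqxx mulr1 big1 ?addr0 // => j /negPf nj.
by rewrite eq_sym nj mulr0.
Qed.

(** Incidence modulo 2 between segments and crossing points for [p = cr], and between segments and
    regions for [p = reg]. *)
Definition bdry (T : finType) (p : dart K -> T) (j : segment K) (t : T) : 'F_2 :=
  (\sum_(d | seg d == j) (p d == t)%:R)%R.

Lemma sum_bdry (T : finType) (p : dart K -> T) (u : T -> 'F_2) d :
  (\sum_t u t * bdry p (seg d) t = u (p d) + u (p (f d)))%R.
Proof. by rewrite sum_indicator (sum_seg (fun e => u (p e))). Qed.

Lemma bdry_bdry x R : (\sum_j bdry (@cr K) j x * bdry (@reg K) j R = 0)%R.
Proof.
rewrite sum_by_seg.
under eq_bigr do rewrite /bdry (sum_seg (fun e => (cr e == x)%:R)%R) mulrDl.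
rewrite big_split /= [X in (_ + X)%R](reindex_inj (inj_comp (@perm_inj _ f) (@perm_inj _ r))) /=.
under [X in (_ + X)%R]eq_bigr do rewrite flipK cr_rot reg_flip_rot.
exact: F2_addxx.
Qed.

Lemma bdry_cr_const (u : crossing K -> 'F_2) :
  (forall d, u (cr d) + u (cr (f d)) = 0)%R -> forall x x', u x = u x'.
Proof.
move=> u0 x x'; have [d ->] := cr_surj x; have [d' ->] := cr_surj x'.
apply: (dart_invariant (phi := fun e => u (cr e))) => e; first by rewrite cr_rot.
exact/esym/F2_eq.
Qed.

Lemma bdry_reg_const (v : region K -> 'F_2) :
  (forall d, v (reg d) + v (reg (f d)) = 0)%R -> forall R R', v R = v R'.
Proof.
move=> v0 R R'; have [d ->] := reg_surj R; have [d' ->] := reg_surj R'.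
have vf e : v (reg (f e)) = v (reg e) by apply/esym/F2_eq.
apply: (dart_invariant (phi := fun e => v (reg e))) => e //.
by rewrite -vf reg_flip_rot.
Qed.

(** Vanishing of the first cohomology modulo 2; Euler's formula supplies the count for
    [complex_exact]. *)
Lemma boundary_exact (w : segment K -> 'F_2) :
    (forall R, \sum_(d | reg d == R) w (seg d) = 0)%R ->
  exists s : crossing K -> 'F_2, forall d, w (seg d) = (s (cr d) + s (cr (f d)))%R.
Proof.
move=> w0.
have [||||R|s sE] := @complex_exact 'F_2 (crossing K) (segment K) (region K)
  (fun x j => bdry (@cr K) j x) (bdry (@reg K)) _ _ _ _ w.
- exact: bdry_bdry.
- by move=> u u0; apply: bdry_cr_const => d; rewrite -sum_bdry u0.
- move=> v v0; apply: bdry_reg_const => d; rewrite -sum_bdry -[RHS](v0 (seg d)).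
  by apply: eq_bigr => R _; rewrite mulrC.
- exact: card_region.
- rewrite sum_by_seg -[RHS](w0 R) [RHS]big_mkcond; apply: eq_bigr => d _.
  by case: eqP => _; rewrite ?mulr1 ?mulr0.
by exists s => d; rewrite sE sum_bdry.
Qed.

(** Otherwise the indicator of the segment is a cocycle, so some [s] on the crossing points changes
    along this segment only. The sum of [s] over all darts is then 0 when grouped by crossing
    points, each having four darts, and 1 when grouped by segments. *)
Lemma no_bridge d : reg (f d) != reg d.
Proof.
apply/eqP => eqR.
have [|s sE] := @boundary_exact (fun j => (j == seg d)%:R%R).
  move=> R; have -> : (\sum_(e | reg e == R) (seg e == seg d)%:R =
      \sum_(e | seg e == seg d) (reg e == R)%:R :> 'F_2)%R.
    rewrite big_mkcond [RHS]big_mkcond; apply: eq_bigr => e _.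
    by do 2!case: (_ == _).
  by rewrite (sum_seg (fun e => (reg e == R)%:R)%R) eqR F2_addxx.
have : (\sum_e s (cr e) = 0)%R.
  rewrite (partition_big (@cr K) xpredT) //= big1 // => x _.
  have [e ->] := cr_surj x; rewrite (sum_cr (fun e => s (cr e))) !cr_rot.
  by rewrite F2_addxx add0r F2_addxx.
rewrite (partition_big (@seg K) xpredT) //= (bigD1 (seg d)) //=.
rewrite (sum_seg (fun e => s (cr e))) -sE eqxx big1 ?addr0 //.
move=> j; have [e ->] := seg_surj j => /negPf ne.
by rewrite (sum_seg (fun e => s (cr e))) -sE ne.
Qed.

(** * Consequences of primality and of the absence of curls *)

Hypothesis K_prime : prime_projection K.

(** If the segments differ, the sum of their indicators is a cocycle, hence the coboundary of a
    function telling the two sides of a curve through both. Primality makes this function constant,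
    yet it changes along [d]. *)
Lemma seg_by_regions d d' :
  reg d = reg d' -> reg (f d) = reg (f d') -> d = d'.
Proof.
move=> eqR eqR'; have [|neq] := eqVneq (seg d) (seg d').
  move/eqP; rewrite segE => /orP[/eqP //|/eqP eqd].
  by have := no_bridge d'; rewrite -eqR eqd eqxx.
have [|s sE] := @boundary_exact (fun j => (j == seg d)%:R + (j == seg d')%:R)%R.
  move=> R; have exch c : (\sum_(e | reg e == R) (seg e == seg c)%:R =
      (reg c == R)%:R + (reg (f c) == R)%:R :> 'F_2)%R.
    rewrite -(sum_seg (fun e => (reg e == R)%:R)%R).
    rewrite big_mkcond [RHS]big_mkcond; apply: eq_bigr => e _.
    by do 2!case: (_ == _).
  by rewrite big_split /= (exch d) (exch d') eqR eqR'; apply: F2_addxx.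
have sideD e : (s (cr e) != 0%R) (+) (s (cr (f e)) != 0%R) =
    (seg e == seg d) (+) (seg e == seg d').
  by rewrite -F2_neq0D -sE; apply: F2_neq0_natD.
have [b sideE] := K_prime eqR eqR' (side := fun x => s x != 0%R) sideD.
by have := sideD d; rewrite !sideE addbb eqxx (negPf neq).
Qed.

Hypothesis K_nocurl : without_curls K.

Lemma next_neq d : next_side K d != d.
Proof.
apply/eqP => fixd; have /eqP := K_nocurl (reg d); apply=> /=.
rewrite (_ : porbit _ d = [set d]) ?cards1 //; apply/setP => e; rewrite inE.
apply/porbitP/eqP => [[n ->]|->]; last by exists 0; rewrite expg0 perm1.
by elim: n => [|n IHn]; rewrite ?expg0 ?perm1 // expgSr permM IHn.
Qed.

Lemma flip_neq_rot d : f d != r d.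
Proof. by apply: contraNneq (next_neq d) => eqf; apply/eqP/(@perm_inj _ r); rewrite rot_next. Qed.

Lemma reg_rot_neq d : reg (r d) != reg d.
Proof. by rewrite -(reg_flip_rot d) eq_sym no_bridge. Qed.

(** If opposite corners lay in one region, the segments of [rot d] and [rot (rot d)] would border
    the same two regions, hence coincide and form a curl. *)
Lemma reg_rot2_neq d : reg (r (r d)) != reg d.
Proof.
apply/eqP => eqR; have : r d = f (r (r d)).
  by apply: seg_by_regions; rewrite ?flipK ?reg_flip_rot.
by move/(congr1 f)/eqP; rewrite flipK (negPf (flip_neq_rot (r d))).
Qed.

(** The four corners at a crossing point lie in distinct regions, so markers can be replaced by
    darts. *)
Lemma corner_inj (d e : dart K) : cr d = cr e -> reg d = reg e -> d = e.
Proof.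
move=> /eqP; rewrite crE => /or4P[]/eqP-> // /eqP.
- by rewrite (negPf (reg_rot_neq e)).
- by rewrite (negPf (reg_rot2_neq e)).
by rewrite -{2}(rot4 e) eq_sym (negPf (reg_rot_neq _)).
Qed.

Lemma seg_rot_neq d : seg (r d) != seg d.
Proof.
rewrite segE negb_or (eq_sym (r d) (f d)) flip_neq_rot andbT.
by have /= := rot_orbit_uniq d; rewrite !inE !negb_or eq_sym => /andP[/andP[]].
Qed.

(** A segment returning to a neighbouring position would form a curl; one returning to the opposite
    position would put two consecutive corners in one region. *)
Lemma no_loop d : cr (f d) != cr d.
Proof.
rewrite crE !negb_or flip_neq flip_neq_rot /=; apply/andP; split; apply/eqP => fd.
  have := reg_next d; rewrite next_sideE fd permK => /eqP.
  by rewrite (negPf (reg_rot_neq d)).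
by have := flip_neq_rot (f d); rewrite flipK fd rot4 eqxx.
Qed.

(* Three edges leave [C]: following the two regions at one cut edge, one comes
   back into [C] through two further cut edges, which coincide only if they
   border the same two regions. *)
Lemma cut_ge3 (C : {set crossing K}) : C != set0 -> C != setT ->
  2 < #|[set d | (cr d \in C) && (cr (f d) \notin C)]|.
Proof.
move=> C0 CT; set cut := [set d | _].
have /set0Pn[d] : cut != set0.
  apply: contraNneq CT => cut0; apply/eqP/setP => x; rewrite inE.
  have [y yC] := set0Pn _ C0; have [d dE] := cr_surj x; have [e eE] := cr_surj y.
  rewrite -yC dE eE; apply: (dart_invariant (phi := fun d => cr d \in C)) => c.
    by rewrite cr_rot.
  have stab c' : cr c' \in C -> cr (f c') \in C.
    move=> c'C; apply: contraT => nc'C; have : c' \in cut by rewrite inE c'C nc'C.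
    by rewrite cut0 inE.
  by apply/idP/idP => /stab; rewrite ?flipK.
rewrite inE => /andP[dC ndC].
have [e1 /and3P[/eqP e1R e1C fe1C]] :
    exists e, [&& reg e == reg d, cr e \notin C & cr (f e) \in C].
  apply/existsP; apply: contraLR dC => /existsPn none.
  apply: (reg_invariant (P := fun e => cr e \notin C) (d := next_side K d)) => [e eR eC||];
    rewrite ?cr_next ?reg_next //.
  by have := none e; rewrite eR reg_next eqxx eC.
have [e2 /andP[/eqP e2R e2C]] : exists e, (reg e == reg (f d)) && (e \in cut).
  apply/existsP; apply: contraNT ndC => /existsPn none.
  apply: (reg_invariant (P := fun e => cr e \in C) (d := next_side K (f d))) => [e eR eC||];
    rewrite ?cr_next ?reg_next ?flipK //.
  by have := none e; rewrite inE eR reg_next eqxx eC /= negbK.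
have uniq3 : uniq [:: d; f e1; e2].
  rewrite /= !inE andbT negb_or -andbA; apply/and3P; split.
  - by apply: contraNneq (no_bridge d) => dE; rewrite {1}dE flipK e1R.
  - by apply: contraNneq (no_bridge d) => dE; rewrite -e2R -dE.
  apply: contraNneq e1C => e12; suff <- : d = e1 by [].
  by apply: seg_by_regions; rewrite ?e12.
rewrite -[3]/(size [:: d; f e1; e2]) -(card_uniqP uniq3).
apply/subset_leq_card/subsetP => e; rewrite !inE => /or3P[]/eqP->.
- by rewrite dC.
- by rewrite flipK fe1C.
by move: e2C; rewrite inE.
Qed.

(** * Counting the regions inside a set of crossing points *)

Definition inner (C : {set crossing K}) : {set region K} :=
  [set R | [forall d, (reg d == R) ==> (cr d \in C)]].

Lemma innerP (C : {set crossing K}) R :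
  reflect (forall d, reg d = R -> cr d \in C) (R \in inner C).
Proof.
rewrite inE; apply: (iffP forallP) => inn d; first by move/eqP; apply/implyP.
by apply/implyP => /eqP; apply: inn.
Qed.

Definition inner_segs (C : {set crossing K}) : {set segment K} :=
  [set j | [forall d, (seg d == j) ==> (cr d \in C)]].

Lemma inner_segsE (C : {set crossing K}) d :
  (seg d \in inner_segs C) = (cr d \in C) && (cr (f d) \in C).
Proof.
rewrite inE; apply/forallP/andP => [inn|[dC fdC] e].
  by split; [have := inn d | have := inn (f d)]; rewrite ?seg_flip eqxx.
by apply/implyP; rewrite segE => /orP[]/eqP->.
Qed.

(** Both sides count the darts at the crossing points of [C]. *)
Lemma card_inner_segs (C : {set crossing K}) :
  #|inner_segs C| * 2 + #|[set d | (cr d \in C) && (cr (f d) \notin C)]| = #|C| * 4.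
Proof.
have -> : #|C| * 4 = #|[pred d | cr d \in C]|.
  rewrite (card_sum_fibers (@cr K)) -sum_nat_const big_mkcond; apply: eq_bigr => x _.
  have [d ->] := cr_surj x; case: ifP => dC.
    rewrite -sum1_card (eq_bigl (fun e => cr e == cr d)) ?(@sum_cr K nat) //.
    by move=> e; rewrite !inE; case: eqP => [->|_]; rewrite ?dC ?andbF.
  apply/esym/eq_card0 => e; rewrite !inE; case: eqP => [->|_]; rewrite ?dC ?andbF //.
rewrite -(cardID [pred d | cr (f d) \in C] [pred d | cr d \in C]); congr (_ + _); last first.
  by apply: eq_card => d; rewrite !inE andbC.
rewrite (card_sum_fibers (@seg K)) -sum_nat_const big_mkcond; apply: eq_bigr => j _.
have [d ->] := seg_surj j; rewrite inner_segsE; case: ifP => dC.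
  rewrite -sum1_card (eq_bigl (fun e => seg e == seg d)) ?(@sum_seg K nat) //.
  move=> e; rewrite !inE segE; case: orP; rewrite ?andbF // andbT.
  by move=> []/eqP->; rewrite ?flipK // andbC.
apply/esym/eq_card0 => e; apply/negbTE; apply: contraFN dC.
rewrite !inE segE => /andP[/andP[fe ce]] /orP[]/eqP eE; apply/andP; split;
  by move: fe ce; rewrite eE ?flipK.
Qed.

(* If [C] is connected, Euler's formula bounds the number of its inner regions,
   because at least three edges leave [C]. *)
Lemma card_inner_lt (C : {set crossing K}) :
  C != set0 -> C != setT -> #|inner C| < #|C|.
Proof.
have [n] := ubnP #|C|; elim: n C => // n IHn C; rewrite ltnS => leCn C0 CT.
pose closed_in (C1 : {set crossing K}) :=
  [forall d, (cr d \in C1) && (cr (f d) \in C) ==> (cr (f d) \in C1)].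
(* If no segment joins [C1] to the rest of [C], every inner region of [C] is inner to one of the two
   pieces, and induction applies to both. *)
have [/existsP[C1 /and3P[C10 C1C clC1]] | /existsPn conC] :=
    boolP [exists C1 : {set crossing K}, [&& C1 != set0, C1 \proper C & closed_in C1]].
  have /andP[sC1 nC1] := C1C.
  have C20 : C :\: C1 != set0 by rewrite setD_eq0.
  have cardC := cardsID C1 C; rewrite (setIidPr sC1) in cardC.
  have C1T : C1 != setT by apply: contraNneq nC1 => ->; apply: subsetT.
  have C2T : C :\: C1 != setT.
    apply: contraNneq C10 => C2T; rewrite -subset0; apply/subsetP => x.
    by have := in_setT x; rewrite -C2T inE => /andP[/negPf->].
  have lt1 := IHn C1 _ C10 C1T; have lt2 := IHn (C :\: C1) _ C20 C2T.
  have gt1 : 0 < #|C1| by rewrite card_gt0.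
  have gt2 : 0 < #|C :\: C1| by rewrite card_gt0.
  suff : #|inner C| <= #|inner C1 :|: inner (C :\: C1)|.
    have := cardsUI (inner C1) (inner (C :\: C1)); clear -lt1 lt2 leCn cardC gt1 gt2; lia.
  apply/subset_leq_card/subsetP => R /innerP RC; have [d dR] := reg_surj R.
  have stab (b : bool) e : reg e = R -> (cr e \in C1) = b -> (cr (next_side K e) \in C1) = b.
    move=> eR; rewrite cr_next; case: b => eC1.
      by have := forallP clC1 e; rewrite eC1 /= -cr_next RC // reg_next.
    apply: contraFF eC1 => feC1; have := forallP clC1 (f e).
    by rewrite flipK feC1 RC.
  have const e : reg e = R -> (cr e \in C1) = (cr d \in C1).
    rewrite dR => eR; apply/eqP.
    apply: (reg_invariant (P := fun e => (cr e \in C1) == (cr d \in C1)) _ _ eR) => // c cR /eqP cC1.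
    by apply/eqP/stab; rewrite // cR.
  have [dC1|dC1] := boolP (cr d \in C1); apply/setUP; [left|right];
    apply/innerP => e eR; rewrite ?inE const ?dC1 ?RC //.
have [x xC] : exists x, x \notin C.
  apply/existsP; rewrite -negb_forall; apply: contra CT => /forallP C_T.
  by apply/eqP/setP => x; rewrite C_T inE.
have : #|C| + #|inner C| <= #|inner_segs C|.+1.
  apply: (complex_card_le_in (a := fun x j => bdry (@cr K) j x) (b := bdry (@reg K))).
  - move=> y R yC /innerP RC; rewrite -[RHS](bdry_bdry y R) [LHS]big_mkcond.
    apply: eq_bigr => j _; have [d ->] := seg_surj j.
    rewrite inner_segsE; case: andP => // out.
    rewrite [X in (_ * X)%R]big1 ?mulr0 // => e; rewrite segE => ed.
    case: eqP => // eR; case: out; have := RC e eR; have := RC (next_side K e).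
    by rewrite reg_next cr_next => /(_ eR); case/orP: ed => /eqP->; rewrite ?flipK.
  - move=> u u0 y y' yC y'C.
    (* A level set of [u] is closed under the segments inside [C], so it is all of [C] by
       connectedness. *)
    pose C1 := [set z in C | u z == u y].
    have := conC C1; rewrite negb_and; case/orP => [/negP[]|].
      by apply/set0Pn; exists y; rewrite inE yC eqxx.
    rewrite negb_and; case/orP => [nprop | /forallPn[d]].
      have /eqP C1C : C1 == C by rewrite eqEproper nprop andbT; apply/subsetP => z; rewrite inE => /andP[].
      by move: y'C; rewrite -C1C inE => /andP[_ /eqP].
    rewrite negb_imply !inE => /andP[/andP[/andP[dC /eqP udy] fdC]].
    rewrite fdC => /negP[]; rewrite -udy eq_sym; apply/eqP/F2_eq.
    pose u' z := if z \in C then u z else 0%R.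
    have := @sum_bdry _ (@cr K) u' d; rewrite /u' dC fdC => <-.
    rewrite -[RHS](u0 (seg d)) ?inner_segsE ?dC // [RHS]big_mkcond.
    by apply: eq_bigr => z _; case: ifP; rewrite ?mul0r.
  - move=> v v0 R RC.
    (* Extended by zero, [v] becomes constant on all regions, and it vanishes at a region incident
       to [x], which is outside [C]. *)
    pose v' R' := if R' \in inner C then v R' else 0%R.
    have [d xd] := cr_surj x.
    have vx : v' (reg d) = 0%R.
      rewrite /v'; case: innerP => // dC; by move: xC; rewrite xd dC.
    have -> : v R = v' R by rewrite /v' RC.
    rewrite -vx; apply: bdry_reg_const => e.
    have [eC|out] := boolP ((cr e \in C) && (cr (f e) \in C)).
      rewrite -sum_bdry -[RHS](v0 (seg e)) ?inner_segsE // [RHS]big_mkcond.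
      by apply: eq_bigr => R' _; rewrite /v'; case: ifP; rewrite ?mul0r // mulrC.
    have v'0 c : (c == e) || (c == f e) -> v' (reg c) = 0%R.
      move=> ce; rewrite /v'; case: innerP => // inn; case/negP: out.
      have := inn _ erefl; have := inn _ (reg_next c); rewrite cr_next.
      by case/orP: ce => /eqP->; rewrite ?flipK => -> ->.
    by rewrite !v'0 ?eqxx ?orbT ?addr0.
(* At least three leaving darts force [#|inner_segs C| <= 2 * #|C| - 2]. *)
by have := card_inner_segs C; have := cut_ge3 C0 CT; lia.
Qed.

(** * Kauffman states as sets of darts, and their existence *)

Variable i : segment K.
Implicit Types S T U : state i.

Definition mk S (d : dart K) : bool := (cr d, reg d) \in val S.

Lemma card_markers S (P : pred (marker K)) :
  #|[set m in val S | P m]| = #|[set d | mk S d && P (cr d, reg d)]|.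
Proof.
rewrite -(card_imset (f := fun d => (cr d, reg d))); last first.
  by move=> d e cE; apply: corner_inj;
    [exact: (congr1 (fun m : marker K => m.1) cE) | exact: (congr1 (fun m : marker K => m.2) cE)].
apply: eq_card => m; rewrite inE; apply/andP/imsetP => [[mS Pm]|[d + ->]]; last first.
  by rewrite inE => /andP.
have /and3P[/forallP inc _ _] := valP S.
have /existsP[d /andP[/eqP dx /eqP dR]] := implyP (inc m) mS.
have mE : m = (cr d, reg d) by rewrite dx dR; case: (m).
by exists d; rewrite // inE /mk -mE mS.
Qed.

Lemma card_mk_cr S x : #|[set d | mk S d && (cr d == x)]| = 1.
Proof.
have /and3P[_ /forallP/(_ x)/eqP <- _] := valP S.
by rewrite (card_markers S (fun m => m.1 == x)).
Qed.

Lemma card_mk_reg S R : #|[set d | mk S d && (reg d == R)]| = ~~ adjacent i R.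
Proof.
have /and3P[_ _ /forallP/(_ R)/eqP <-] := valP S.
by rewrite (card_markers S (fun m => m.2 == R)).
Qed.

Lemma mk_nonadj S d : mk S d -> ~~ adjacent i (reg d).
Proof.
move=> dS; have := card_mk_reg S (reg d); case: (adjacent _ _) => //= /eqP.
by rewrite cards_eq0 => /eqP/setP/(_ d); rewrite !inE dS eqxx.
Qed.

Lemma mk_inj S T : mk S =1 mk T -> S = T.
Proof.
move=> eqST; apply/val_inj/setP => m.
have sub S1 S2 : mk S1 =1 mk S2 -> m \in val S1 -> m \in val S2.
  move=> eqmk mS; have /and3P[/forallP inc _ _] := valP S1.
  have /existsP[d /andP[/eqP dx /eqP dR]] := implyP (inc m) mS.
  have mE : m = (cr d, reg d) by rewrite dx dR; case: (m).
  by move: mS; rewrite mE -/(mk S1 d) eqmk.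
by apply/idP/idP; apply: sub.
Qed.

Lemma mk_surj (N : pred (dart K)) :
    (forall x, #|[set d | N d && (cr d == x)]| = 1) ->
    (forall R, #|[set d | N d && (reg d == R)]| = ~~ adjacent i R) ->
  exists S, mk S =1 N.
Proof.
move=> Ncr Nreg; pose c (d : dart K) := (cr d, reg d).
have c_inj : injective c by move=> d e cE; apply: corner_inj;
    [exact: (congr1 (fun m : marker K => m.1) cE) | exact: (congr1 (fun m : marker K => m.2) cE)].
pose S := [set c d | d in N].
have cardS (P : pred (marker K)) : #|[set m in S | P m]| = #|[set d | N d && P (c d)]|.
  rewrite -(card_imset _ c_inj); apply: eq_card => m; rewrite inE; apply/andP/imsetP.
    by move=> [/imsetP[d dN ->] Pd]; exists d; rewrite // inE Pd andbT; apply: dN.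
  by move=> [d + ->]; rewrite inE => /andP[dN Pd]; rewrite imset_f.
have stS : is_state i S.
  apply/and3P; split; apply/forallP; [move=> m | move=> x | move=> R].
  - by apply/implyP => /imsetP[d _ ->]; apply/existsP; exists d; rewrite !eqxx.
  - by rewrite (cardS (fun m => m.1 == x)) Ncr.
  by rewrite (cardS (fun m => m.2 == R)) Nreg.
exists (Sub S stS) => d; rewrite /mk /= -/(c d).
by apply/imsetP/idP => [[e eN /c_inj ->]|dN]; last exists d.
Qed.

Lemma adjacentE d R : adjacent (seg d) R = (reg d == R) || (reg (f d) == R).
Proof.
apply/existsP/idP => [[e /andP[]]|/orP[]RE]; last 2 first.
- by exists d; rewrite eqxx.
- by exists (f d); rewrite seg_flip eqxx.
by rewrite segE => /orP[]/eqP-> -> //; rewrite orbT.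
Qed.

Lemma card_nonadj : #|[pred R | ~~ adjacent i R]| = #|crossing K|.
Proof.
have [d iE] := seg_surj i; have := card_region.
have := card_crossing_seg K; have := cardC (adjacent i).
have -> : #|adjacent i| = 2.
  transitivity #|[set reg d; reg (f d)]|; last by rewrite cards2 eq_sym no_bridge.
  by apply: eq_card => R; rewrite -[LHS]/(adjacent i R) iE adjacentE !inE ![_ == R]eq_sym.
have -> : #|[predC adjacent i]| = #|[pred R | ~~ adjacent i R]| by apply: eq_card.
by lia.
Qed.

(** Hall's theorem matches the regions away from [i] with crossing points, the region of [d] being
    forced to take [cr d]. The strict inequality of [card_inner_lt] leaves room for withdrawing
    [cr d] from the other regions. *)
Lemma state_through d : ~~ adjacent i (reg d) -> exists S, mk S d.
Proof.
move=> dna; pose A := {R | ~~ adjacent i R}; pose Rd : A := Sub (reg d) dna.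
pose N (R : A) : {set crossing K} :=
  if R == Rd then [set cr d] else [set x | incident x (val R)] :\ cr d.
have hallN (X : {set A}) : #|X| <= #|\bigcup_(R in X) N R|.
  pose X' := X :\ Rd; pose C := \bigcup_(R in X') [set x | incident x (val R)].
  have XE : #|X| = (Rd \in X) + #|X'| by rewrite (cardsD1 Rd).
  have subC : C :\ cr d \subset \bigcup_(R in X) N R.
    apply/subsetP => x /setD1P[xd /bigcupP[R /setD1P[RRd RX] Rx]].
    by apply/bigcupP; exists R; rewrite // /N (negPf RRd) in_setD1 xd.
  have cardC : (Rd \in X) + #|C :\ cr d| <= #|\bigcup_(R in X) N R|.
    have [RdX|_] := boolP (Rd \in X); last by rewrite add0n subset_leq_card.
    rewrite [leqRHS](cardsD1 (cr d)); apply: leq_add.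
      have -> // : cr d \in \bigcup_(R in X) N R.
      by apply/bigcupP; exists Rd; rewrite // /N eqxx inE.
    apply/subset_leq_card/subsetP => x xC; rewrite in_setD1 (subsetP subC) // andbT.
    by case/setD1P: xC.
  rewrite XE; apply: leq_trans cardC; rewrite leq_add2l.
  have [->|X'0] := eqVneq X' set0; first by rewrite cards0.
  suff : #|X'| < #|C| by rewrite (cardsD1 (cr d) C); case: (_ \in _) => /=; lia.
  have [R0 R0X] := set0Pn _ X'0.
  have C0 : C != set0.
    have [e eR] := reg_surj (val R0); apply/set0Pn; exists (cr e); apply/bigcupP.
    by exists R0; rewrite // inE; apply/existsP; exists e; rewrite eR !eqxx.
  (* If [C] contains every crossing point, strictness comes from [Rd] missing in [X'], as there are
     as many regions away from [i] as crossing points. *)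
  have [CT|CT] := eqVneq C setT.
    rewrite CT cardsT -card_nonadj -card_sig -cardsT.
    apply: proper_card; rewrite properT; apply/negP => /eqP X'T.
    by have := in_setT Rd; rewrite -X'T !inE eqxx.
  apply: leq_ltn_trans (card_inner_lt C0 CT).
  rewrite -(card_imset _ val_inj); apply/subset_leq_card/subsetP => _ /imsetP[R RX ->].
  apply/innerP => e eR; apply/bigcupP; exists R; rewrite // inE.
  by apply/existsP; exists e; rewrite eR !eqxx.
have [g g_inj gN] := hall_marriage hallN.
have gRd : g Rd = cr d by have := gN Rd; rewrite /N eqxx inE => /eqP.
have g_inc R : exists e, cr e = g R /\ reg e = val R.
  have := gN R; rewrite /N; case: eqP => [-> _|_ /setD1P[_]]; first by exists d; rewrite gRd.
  by rewrite inE => /existsP[e /andP[/eqP ? /eqP ?]]; exists e.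
have g_surj x : exists R, x = g R.
  apply/codomP/(inj_card_onto g_inj).
  by rewrite [leqRHS]card_sig -card_nonadj; apply/eq_leq/eq_card.
have [||S SE] := @mk_surj (fun e => [exists R : A, (reg e == val R) && (cr e == g R)]).
- move=> x; have [R xR] := g_surj x; have [e [ex eR]] := g_inc R.
  rewrite (_ : [set _ | _] = [set e]) ?cards1 //; apply/setP => c; rewrite !inE.
  apply/andP/eqP => [[/existsP[R' /andP[/eqP cR /eqP cx]] /eqP cx']|->].
    apply: corner_inj; first by rewrite cx' ex.
    by rewrite cR eR; congr val; apply: g_inj; rewrite -cx cx'.
  by rewrite ex xR; split=> //; apply/existsP; exists R; rewrite eR !eqxx.
- move=> R; have [Radj|Rna] := boolP (adjacent i R) => /=.
    apply: eq_card0 => c; rewrite !inE; apply/negP => /andP[/existsP[R' /andP[/eqP cR' _]] /eqP cR].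
    by have /negP[] := valP R'; rewrite /= -cR' cR.
  have [e [ex eR]] := g_inc (Sub R Rna).
  rewrite (_ : [set _ | _] = [set e]) ?cards1 //; apply/setP => c; rewrite !inE.
  apply/andP/eqP => [[/existsP[R' /andP[/eqP cR' /eqP cx]] /eqP cR]|->].
    apply: corner_inj; last by rewrite cR eR.
    by rewrite cx ex; congr g; apply: val_inj; rewrite -[LHS]cR' cR.
  by rewrite eR; split; rewrite /= ?eqxx //; apply/existsP; exists (Sub R Rna); rewrite ex !eqxx.
by exists S; rewrite SE; apply/existsP; exists Rd; rewrite gRd !eqxx.
Qed.

(** * Height functions between two states *)

Section Heights.
Local Open Scope ring_scope.

Lemma sum_cr_rot (V : nmodType) (F : segment K -> V) x :
  \sum_(d | cr d == x) F (seg (r d)) = \sum_(d | cr d == x) F (seg d).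
Proof.
rewrite [RHS](reindex_inj (@perm_inj _ r)) /=.
by apply: eq_bigl => d; rewrite cr_rot.
Qed.

Lemma sum_reg_rot (V : nmodType) (F : segment K -> V) R :
  \sum_(d | reg d == R) F (seg (r d)) = \sum_(d | reg d == R) F (seg d).
Proof.
rewrite [LHS](reindex_inj (@perm_inj _ (next_side K))) /=.
by apply: eq_big => [d|d _]; rewrite ?reg_next // rot_next seg_flip.
Qed.

Lemma sum_mk (V : pzSemiRingType) S (P : pred (dart K)) :
  \sum_(d | P d) (mk S d)%:R = (#|[set d | mk S d && P d]|)%:R :> V.
Proof.
rewrite -sum1_card natr_sum big_mkcond [RHS]big_mkcond; apply: eq_bigr => d _.
by rewrite inE; case: (mk S d); case: (P d).
Qed.

(** The medial graph has segments as vertices, corners as edges, and crossing points and regions as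
    faces. It decomposes the sphere again, so a cochain with zero sum around every face is a
    coboundary. *)
Lemma medial_exact (w : dart K -> rat) :
    (forall x, \sum_(d | cr d == x) w d = 0) ->
    (forall R, \sum_(d | reg d == R) w d = 0) ->
  exists u : segment K -> rat, forall d, w d = u (seg (r d)) - u (seg d).
Proof.
move=> wcr wreg.
(* A corner borders one crossing point face and one region face, with opposite orientations; with
   these signs the constants form the kernel. *)
pose b d (l : crossing K + region K) : rat :=
  match l with inl x => (cr d == x)%:R | inr R => - (reg d == R)%:R end.
have sum_a (u : segment K -> rat) d :
    \sum_j u j * ((seg (r d) == j)%:R - (seg d == j)%:R) = u (seg (r d)) - u (seg d).
  under eq_bigr do rewrite mulrBr; rewrite sumrB.
  by congr (_ - _); rewrite -[RHS](big_pred1_eq (@GRing.add rat) _ u) [RHS]big_mkcond;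
    apply: eq_bigr => j _; rewrite eq_sym; case: eqP; rewrite ?mulr1 ?mulr0.
have sum_b d (v : crossing K + region K -> rat) :
    \sum_l b d l * v l = v (inl (cr d)) - v (inr (reg d)).
  rewrite big_sumType /=; congr (_ + _).
    rewrite (bigD1 (cr d)) //= eqxx mul1r big1 ?addr0 // => x /negPf nx.
    by rewrite eq_sym nx mul0r.
  rewrite (bigD1 (reg d)) //= eqxx mulN1r big1 ?addr0 // => x /negPf nx.
  by rewrite eq_sym nx oppr0 mul0r.
have sum_wb (g : dart K -> rat) l : \sum_d g d * b d l =
    match l with inl x => \sum_(d | cr d == x) g d | inr R => - \sum_(d | reg d == R) g d end.
  case: l => [x|R] /=; rewrite ?[in RHS]big_mkcond -?sumrN; apply: eq_bigr => d _;
    by case: eqP; rewrite ?mulr1 ?mulr0 ?mulrN1 ?oppr0 ?mulr0.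
have [||||l|u uE] := @complex_exact rat (segment K) (dart K) (crossing K + region K)%type
  (fun j d => (seg (r d) == j)%:R - (seg d == j)%:R) b _ _ _ _ w.
- move=> j l; rewrite sum_wb; case: l => [x|R].
    by rewrite sumrB (sum_cr_rot (fun j' => (j' == j)%:R)) subrr.
  by rewrite sumrB (sum_reg_rot (fun j' => (j' == j)%:R)) subrr oppr0.
- move=> u u0 j j'; have [d ->] := seg_surj j; have [d' ->] := seg_surj j'.
  apply: (dart_invariant (phi := fun d => u (seg d))) => e; last by rewrite seg_flip.
  by apply/eqP; rewrite -subr_eq0 -sum_a u0.
- move=> v v0; have vE d : v (inl (cr d)) = v (inr (reg d)).
    by apply/eqP; rewrite -subr_eq0 -sum_b v0.
  have const d d' : v (inl (cr d)) = v (inl (cr d')).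
    apply: (dart_invariant (phi := fun d => v (inl (cr d)))) => e; first by rewrite cr_rot.
    rewrite vE -(permKV r e) reg_flip_rot -vE -(cr_rot _) //.
  have vl l : exists d, v l = v (inl (cr d)).
    case: l => [x|R]; first by have [d ->] := cr_surj x; exists d.
    by have [d ->] := reg_surj R; exists d; rewrite vE.
  by move=> l l'; have [d ->] := vl l; have [d' ->] := vl l'.
- rewrite card_sum (card_region) card_dart_seg; lia.
- by rewrite sum_wb; case: l => [x|R]; rewrite ?wcr ?wreg ?oppr0.
by exists u => d; rewrite uE sum_a.
Qed.

(** Both states use each cell equally often, so their difference is a coboundary. Normalised at [i],
    it is integral because its increments are and the diagram is connected. *)
Lemma height_exists S T : exists h : segment K -> int,
  h i = 0 /\ forall d, (mk T d)%:R - (mk S d)%:R = h (seg (r d)) - h (seg d).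
Proof.
have [x|R|u uE] := @medial_exact (fun d => (mk T d)%:R - (mk S d)%:R).
- by rewrite sumrB !sum_mk !card_mk_cr // subrr.
- by rewrite sumrB !sum_mk !card_mk_reg // subrr.
pose v j := u j - u i.
have vE d : (mk T d)%:R - (mk S d)%:R = v (seg (r d)) - v (seg d).
  by rewrite uE /v opprB addrA subrK.
have [d0 iE] := seg_surj i.
have v_int j : v j \is a Num.int.
  have [d ->] := seg_surj j.
  rewrite (dart_invariant (phi := fun d => v (seg d) \is a Num.int) _ _ d d0).
  - by rewrite -iE /v subrr.
  - move=> e; rewrite -[v (seg (r e))](subrK (v (seg e))) -vE.
    by rewrite rpredDl // rpredB // rpred_nat.
  - by move=> e; rewrite seg_flip.
exists (fun j => Num.floor (v j)); split; first by rewrite /v subrr floor0.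
move=> d; apply: (@intr_inj rat); rewrite !rmorphB /= !floorK // -vE.
by rewrite !rmorph_nat.
Qed.

Definition ht S T : segment K -> int :=
  sval (constructive_indefinite_description _ (height_exists S T)).

Lemma ht_i S T : ht S T i = 0.
Proof. by rewrite /ht; case: constructive_indefinite_description => h []. Qed.

Lemma ht_rot S T d : ht S T (seg (r d)) - ht S T (seg d) = (mk T d)%:R - (mk S d)%:R.
Proof. by rewrite /ht; case: constructive_indefinite_description => h []. Qed.

Lemma ht_uniq S T (h : segment K -> int) : h i = 0 ->
    (forall d, h (seg (r d)) - h (seg d) = (mk T d)%:R - (mk S d)%:R) ->
  forall j, ht S T j = h j.
Proof.
move=> hi hr j; have [d ->] := seg_surj j; have [d0 iE] := seg_surj i.
apply/eqP; rewrite -subr_eq0.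
have -> : ht S T (seg d) - h (seg d) = ht S T (seg d0) - h (seg d0).
  apply: (dart_invariant (phi := fun e => ht S T (seg e) - h (seg e))) => e; last by rewrite seg_flip.
  by have := ht_rot S T e; have := hr e; lia.
by rewrite -iE ht_i hi.
Qed.

Lemma ht_add S T U j : ht S U j = ht S T j + ht T U j.
Proof.
apply: (ht_uniq (h := fun j => ht S T j + ht T U j)); first by rewrite !ht_i.
by move=> d; have := ht_rot S T d; have := ht_rot T U d; lia.
Qed.

Lemma ht_refl S j : ht S S j = 0.
Proof. by apply: (ht_uniq (h := fun=> 0)) => // d; rewrite !subrr. Qed.

Lemma ht_inj S T U : ht S T =1 ht S U -> T = U.
Proof.
move=> eqh; apply: mk_inj => // d; have := ht_rot S T d; have := ht_rot S U d.
by rewrite !eqh; do 2!case: mk; lia.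
Qed.

(** No state has a marker in a region next to [i], so heights are constant around it, and [i] is on
    its boundary. *)
Lemma ht_adjacent S T d : adjacent i (reg d) -> ht S T (seg d) = 0.
Proof.
move=> adj_d; have /existsP[e /andP[/eqP ei /eqP ed]] := adj_d.
have [_] : reg d = reg d /\ ht S T (seg d) == 0; last by move/eqP.
split=> //; apply: (reg_invariant (P := fun e => ht S T (seg e) == 0) (d := e)) => //; last first.
  by rewrite ei ht_i.
move=> c ce /eqP hc.
have nm (U : state i) : mk U (next_side K c) = false.
  by apply/negP => /(mk_nonadj); rewrite reg_next ce ed adj_d.
by have := ht_rot S T (next_side K c); rewrite !nm rot_next seg_flip hc subrr sub0r => /eqP; rewrite oppr_eq0.
Qed.

(** Increments of [h] cancel around each crossing point and each region, so [N] meets every cell as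
    often as [S] does. *)
Lemma state_of_height S (h : segment K -> int) (N : pred (dart K)) : h i = 0 ->
    (forall d, h (seg (r d)) - h (seg d) = (N d)%:R - (mk S d)%:R) ->
  exists T, mk T =1 N /\ ht S T =1 h.
Proof.
move=> hi hr.
have cardN (P : pred (dart K)) : \sum_(d | P d) h (seg (r d)) = \sum_(d | P d) h (seg d) ->
    #|[set d | N d && P d]| = #|[set d | mk S d && P d]|.
  move=> eqh; apply/eqP; rewrite -eqz_nat; apply/eqP.
  have : \sum_(d | P d) (h (seg (r d)) - h (seg d)) = 0 by rewrite sumrB eqh subrr.
  under eq_bigr do rewrite hr; rewrite sumrB sum_mk => /eqP; rewrite subr_eq0 => /eqP.
  rewrite natz => <-; rewrite -natz -sum1_card natr_sum big_mkcond [RHS]big_mkcond.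
  by apply: eq_bigr => d _; rewrite inE; case: (N d); case: (P d).
have [x|R|T TN] := @mk_surj N.
- by rewrite cardN ?card_mk_cr //; apply: sum_cr_rot.
- by rewrite cardN ?card_mk_reg //; apply: sum_reg_rot.
by exists T; split=> //; apply: ht_uniq => // d; rewrite TN.
Qed.

End Heights.

(** * Transpositions and lattice operations in terms of heights *)

Section Transpositions.
Local Open Scope ring_scope.

Lemma mk_uniq S d e : mk S d -> mk S e -> cr d = cr e -> d = e.
Proof.
move=> dS eS de; have /eqP/cards1P[c cE] := card_mk_cr S (cr d).
have : d \in [set c] by rewrite -cE inE dS eqxx.
have : e \in [set c] by rewrite -cE inE eS de eqxx.
by rewrite !inE => /eqP-> /eqP->.
Qed.

Lemma mk_seg_neq S d : mk S d -> seg d != i.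
Proof.
move/(mk_nonadj); apply: contraNneq => <-.
by rewrite adjacentE eqxx.
Qed.

(** The indicator of [j] falls along the corners that start at [j] and rises along those that end
    there: these are the markers removed and added by the transposition. *)
Lemma ccwP j S T :
  reflect (forall k, ht S T k = (k == j)%:R) (ccw_transposition j S T).
Proof.
(* [p d] is the corner at [cr d] on the left of [d]. *)
pose p : dart K -> dart K := (r^-1)%g.
have rp e : r (p e) = e by rewrite /p permKV.

have cr_p e : cr (p e) = cr e by rewrite -cr_rot rp.
have reg_p e : reg (p e) = reg (f e) by rewrite -reg_flip_rot rp.
have segj d e : seg d == j -> (seg e == j) = (e == d) || (e == f d).
  by move=> /eqP<-; rewrite segE.
have segrj d e : seg d == j -> (seg (r e) == j) = (e == p d) || (e == p (f d)).
  by move=> dj; rewrite (segj d) // -2!(inj_eq (@perm_inj _ r) e) !rp.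
have c_inj (d e : dart K) : ((cr d, reg d) == (cr e, reg e)) = (d == e).
  apply/eqP/eqP => [de|-> //]; apply: (corner_inj).
    exact: (congr1 (fun m : marker K => m.1) de).
  exact: (congr1 (fun m : marker K => m.2) de).
have mE (d : dart K) : (cr d, reg (f d)) = (cr (p d), reg (p d)) by rewrite cr_p reg_p.
have mE' (d : dart K) : (cr (f d), reg d) = (cr (p (f d)), reg (p (f d))) by rewrite cr_p reg_p flipK.
apply: (iffP existsP) => [[d /and5P[dj dS fdS pdT /andP[pfdT /eqP eqST]]] k | htE].
  rewrite mE in pdT eqST; rewrite mE' in pfdT eqST.
  apply: (ht_uniq (h := fun k => (k == j)%:R)) => [|e].
    by rewrite -(eqP dj) eq_sym (negPf (mk_seg_neq dS)).
  have /setP/(_ (cr e, reg e)) := eqST; rewrite !inE !c_inj -/(mk S e) -/(mk T e).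
  rewrite -(segj _ _ dj) -(segrj _ _ dj); have := seg_rot_neq e.
  have [ej|] := boolP (seg e == j).
    have -> : mk S e by move: ej; rewrite (segj _ _ dj) => /orP[]/eqP->.
    by rewrite (eqP ej) => /negPf -> /= <-.
  have [ej _ _|_ _ _ /= ->] := boolP (seg (r e) == j).
  have -> : mk T e by move: ej; rewrite (segrj _ _ dj) => /orP[]/eqP->.
  by move=> /= ->.
by rewrite !subrr.
have mkE e : (mk T e)%:R - (mk S e)%:R = (seg (r e) == j)%:R - (seg e == j)%:R :> int.
  by rewrite -(ht_rot) !htE.
have [d dj] := seg_surj j; have /eqP {}dj : seg d = j by [].
have S1 e : seg e == j -> mk S e /\ mk T e = false.
  move=> ej; have := mkE e; have := seg_rot_neq e; rewrite (eqP ej) eqxx => /negPf ->.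
  by case: (mk S e); case: (mk T e).
have T1 e : seg (r e) == j -> mk T e /\ mk S e = false.
  move=> ej; have := mkE e; have := seg_rot_neq e; rewrite (eqP ej) eqxx eq_sym => /negPf ->.
  by case: (mk S e); case: (mk T e).
exists d; rewrite mE mE' -!/(mk _ _) dj.
rewrite !(S1 d dj).1 (S1 (f d) _).1 ?seg_flip // (T1 (p d) _).1 ?rp // (T1 (p (f d)) _).1 ?rp ?seg_flip //=.
apply/eqP/setP => m.
have incm U : m \in val U -> exists e, m = (cr e, reg e).
  have /and3P[/forallP inc _ _] := valP U => mU.
  have /existsP[e /andP[/eqP dx /eqP dR]] := implyP (inc m) mU.
  by exists e; rewrite dx dR; case: (m).
suff corner e : m = (cr e, reg e) -> (m \in val S :\: [set (cr d, reg d); (cr (f d), reg (f d))]) =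
    (m \in val T :\: [set (cr (p d), reg (p d)); (cr (p (f d)), reg (p (f d)))]).
  apply/idP/idP => mm; move: (mm); rewrite inE => /andP[_ /incm[e /corner]]; rewrite mm //.
move=> ->; rewrite !inE !c_inj -/(mk S e) -/(mk T e) -(segj _ _ dj) -(segrj _ _ dj).
have [/S1[_ ->]|nej] := boolP (seg e == j); first by rewrite andbF.
have [/T1[_ ->]|nrej] := boolP (seg (r e) == j); first by rewrite andbF.
have := mkE e; rewrite (negPf nej) (negPf nrej).
by case: (mk S e); case: (mk T e).
Qed.

Lemma ht_step S T : (forall j, 0 <= ht S T j) -> S != T ->
  exists j U, (forall k, ht S U k = (k == j)%:R) /\ forall k, 0 <= ht U T k.
Proof.
move=> leST nST.
have [j0 j0P] : exists j, 0 < ht S T j.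
  apply/existsP; apply: contraNT nST => /existsPn none; apply/eqP.
  apply: (ht_inj (S := S)) => j.
  by rewrite ht_refl; apply/eqP; rewrite eq_le leST leNgt none.
pose tot j := \sum_(U : state i) ht S U j.
have [j jP maxj] : exists2 j, 0 < ht S T j & forall k, 0 < ht S T k -> tot k <= tot j.
  exists [arg max_(j > j0 | 0 < ht S T j) tot j]%O; by case: Order.TotalTheory.arg_maxP.
(* If the corner of [d] were not a marker of [S], no height measured from [S] would drop from
   [seg d] to [seg (rot d)], and that of a state through [d] would rise; this contradicts the choice
   of [j]. *)
have jS d : seg d = j -> mk S d.
  move=> dj; apply: contraT => /negPf ndS.
  have hr U : ht S U (seg (r d)) = ht S U (seg d) + (mk U d)%:R.
    by have := ht_rot S U d; rewrite ndS; lia.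
  have [|U0 U0d] := @state_through d.
    by apply: contraTN jP => adj; rewrite -dj ht_adjacent // ltxx.
  have /maxj : 0 < ht S T (seg (r d)) by rewrite hr dj ltr_wpDr.
  rewrite /tot; under eq_bigr do rewrite hr; rewrite dj big_split /= gerDl.
  rewrite (bigD1 U0) //= U0d leNgt ltr_wpDr //.
  by apply: sumr_ge0 => U _; apply: ler0n.
have ji : j != i by apply: contraTneq jP => ->; rewrite ht_i ltxx.
have [|e|U [UE htU]] := @state_of_height S (fun k => (k == j)%:R)
  (fun e => (seg e != j) && ((seg (r e) == j) || mk S e)).
- by rewrite eq_sym (negPf ji).
- have := seg_rot_neq e; have [/[dup] ej /eqP/jS -> |nej] := boolP (seg e == j).
    by rewrite (eqP ej) => /negPf->.
  have [/eqP/jS reS _|nrej _] := boolP (seg (r e) == j); last by rewrite /= !subrr.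
  (* The corner of [rot e] is a marker at the same crossing point, so that of [e] is free and can
     become one. *)
  suff -> : mk S e = false by [].
  apply: contraTF reS => eS; apply/negP => reS.
  by have := seg_rot_neq e; rewrite (mk_uniq reS eS) ?cr_rot ?eqxx.
exists j, U; split=> // k; have := ht_add S U T k.
rewrite htU; have := leST k; have [->|_] := eqVneq; first by move: jP; lia.
by lia.
Qed.

(** With [b] telling whether a corner is a marker of [R0], the admissible increments along it are
    [- b] and [1 - b]. An operation that preserves this condition and fixes 0 produces the height of
    a state. *)
Let extremum (m : int -> int -> int) :
    (forall (s t s' t' : int) (b : bool), s' - s = - b%:R \/ s' - s = 1 - b%:R ->
       t' - t = - b%:R \/ t' - t = 1 - b%:R ->
       m s' t' - m s t = - b%:R \/ m s' t' - m s t = 1 - b%:R) ->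
    m 0 0 = 0 ->
  forall R0 S T, exists U, forall j, ht R0 U j = m (ht R0 S j) (ht R0 T j).
Proof.
move=> mP m0 R0 S T; pose h j := m (ht R0 S j) (ht R0 T j).
have [|d|U [_ UE]] := @state_of_height R0 h
  (fun d => h (seg (r d)) - h (seg d) == 1 - (mk R0 d)%:R); last by exists U.
- by rewrite /h !ht_i.
have := @mP (ht R0 S (seg d)) (ht R0 T (seg d)) (ht R0 S (seg (r d))) (ht R0 T (seg (r d))) (mk R0 d).
rewrite !ht_rot -!/(h _); move: (h _ - h _) => z.
by case=> [||->|->]; case: (mk R0 d); try case: (mk S d); try case: (mk T d); rewrite ?eqxx /=; lia.
Qed.

Lemma ht_min R0 S T : exists U, forall j, ht R0 U j = Num.min (ht R0 S j) (ht R0 T j).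
Proof.
apply: (extremum (m := Num.min)) => // s t s' t' b; rewrite /Num.min.
by do 2!case: ifP; case: b; lia.
Qed.

Lemma ht_max R0 S T : exists U, forall j, ht R0 U j = Num.max (ht R0 S j) (ht R0 T j).
Proof.
apply: (extremum (m := Num.max)) => // s t s' t' b; rewrite /Num.max.
by do 2!case: ifP; case: b; lia.
Qed.

Lemma state_exists : inhabited (state i).
Proof.
have [x0 _ _] := K_cell; have : (0 < #|[pred R | ~~ adjacent i R]|)%N by rewrite card_nonadj.
case/card_gt0P => R; have [d ->] := reg_surj R => dna.
have [S _] := state_through dna.
exact: (inhabits S).
Qed.

(** A state of least total height is pointwise least, by taking minima. *)
Lemma min_state : exists S0, forall S j, 0 <= ht S0 S j.
Proof.
have [R0] := state_exists.
exists [arg min_(S < R0) \sum_j ht R0 S j]%O.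
case: Order.TotalTheory.arg_minP => // S0 _ minS0 S j.
have [U UE] := ht_min R0 S0 S.
have := ht_add R0 S0 S j.
suff : ht R0 S0 j <= ht R0 S j by lia.
rewrite leNgt; apply/negP => ltj.
have := minS0 U isT; rewrite leNgt; case/negP.
rewrite (bigD1 j) //= [ltRHS](bigD1 j) //= ltr_leD //.
  by rewrite UE gt_min ltj orbT.
by apply: ler_sum => k _; rewrite UE ge_min lexx.
Qed.

End Transpositions.

(** * Levels above the minimal state, and the order of states *)

Variable S0 : state i.
Hypothesis S0_min : forall S j, (0 <= ht S0 S j)%R.

Definition level S j : nat := `|ht S0 S j|%N.
Local Notation H := level.

Lemma levelE S j : Posz (H S j) = ht S0 S j.
Proof. by rewrite /level gez0_abs. Qed.

Lemma ht_level S T j : ht S T j = ((H T j)%:Z - (H S j)%:Z)%R.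
Proof. by rewrite !levelE; have := ht_add S0 S T j; lia. Qed.

(** Levels drop by at most one along a corner, and only at markers of [S0]; for the maximal state
    this compares the dimensions at the ends of an arrow. *)
Lemma level_rot S d : H S (seg (r d)) + mk S0 d = H S (seg d) + mk S d.
Proof.
by have := ht_rot S0 S d; rewrite -!levelE; do 2!case: (mk _ _); lia.
Qed.

Lemma level_i S : H S i = 0.
Proof. by apply/eqP; rewrite -eqz_nat levelE ht_i. Qed.

Lemma level_inj S T : H S =1 H T -> S = T.
Proof.
move=> eqH; apply: (ht_inj (S := S0)) => j.
by rewrite -!levelE eqH.
Qed.

Lemma level_min S T : exists U, forall j, H U j = minn (H S j) (H T j).
Proof.
have [U UE] := ht_min S0 S T; exists U => j.
by have := UE j; rewrite -!levelE; lia.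
Qed.

Lemma level_max S T : exists U, forall j, H U j = maxn (H S j) (H T j).
Proof.
have [U UE] := ht_max S0 S T; exists U => j.
by have := UE j; rewrite -!levelE; lia.
Qed.

Lemma level_S0 j : H S0 j = 0.
Proof. by apply/eqP; rewrite -eqz_nat levelE ht_refl. Qed.

Lemma level_bot : exists S, forall j, H S j = 0.
Proof. by exists S0; apply: level_S0. Qed.

Lemma hle_ht S T : reflect (forall j, (0 <= ht S T j)%R) (hle H S T).
Proof.
by apply: (iffP forallP) => leST j; have := leST j; rewrite ht_level; lia.
Qed.

Lemma level_step S T : hle H S T -> S != T ->
  exists j U, (forall k, H U k = H S k + (k == j)) /\ hle H U T.
Proof.
move=> /hle_ht leST /(ht_step leST)[j [U [UE leUT]]]; exists j, U; split; last exact/hle_ht.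
by move=> k; have := UE k; rewrite ht_level; case: eqP; lia.
Qed.

Lemma ccw_levelP j S T :
  reflect (forall k, H T k = H S k + (k == j)) (ccw_transposition j S T).
Proof.
apply: (iffP (ccwP j S T)) => htE k; have := htE k;
  by rewrite ht_level; case: eqP; lia.
Qed.

Lemma connect_hle S T : connect (@ccw_step K i) S T = hle H S T.
Proof.
apply/idP/idP => [/connectP[p]|].
  elim: p S => [|U p IHp] S /=; first by move=> _ ->; apply: hle_refl.
  move=> /andP[/existsP[j /ccw_levelP UE] /IHp{}IHp] /IHp; apply: hle_trans.
  by apply/forallP => k; rewrite UE leq_addr.
have [n] := ubnP (\sum_j H T j - \sum_j H S j); elim: n S => // n IHn S.
rewrite ltnS => len leST; have [->|nST] := eqVneq S T; first exact: connect0.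
have [j [U [UE leUT]]] := level_step leST nST.
have ltSU : \sum_k H S k < \sum_k H U k.
  apply: (sum_height_lt level_inj); first by apply/forallP => k; rewrite UE leq_addr.
  by apply/eqP => eqSU; have := UE j; rewrite -eqSU eqxx; lia.
apply: (@connect_trans _ _ U); last first.
  apply: IHn => //; have : \sum_k H U k <= \sum_k H T k by apply: leq_sum => k _; apply: (forallP leUT).
  by move: len ltSU; lia.
by apply: connect1; apply/existsP; exists j; apply/ccw_levelP.
Qed.

Lemma state_ltE S T : state_lt S T = (S != T) && hle H S T.
Proof.
apply/existsP/andP => [[U /andP[/existsP[j /ccw_levelP UE]]]|[nST leST]].
  rewrite connect_hle => /forallP leUT; split.
    by apply/eqP => eqST; have := leUT j; rewrite UE eqST eqxx; lia.
  by apply/forallP => k; have := leUT k; rewrite UE; lia.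
have [j [U [UE leUT]]] := level_step leST nST.
exists U; rewrite connect_hle leUT andbT; apply/existsP; exists j; exact/ccw_levelP.
Qed.

Lemma state_leE S T : state_le S T = hle H S T.
Proof. by rewrite /state_le state_ltE; case: eqVneq => [->|] //=; rewrite hle_refl. Qed.

Lemma minimal_stateE S : minimal_state S = (S == S0).
Proof.
apply/forallP/eqP => [minS|-> T].
  have := minS S0; rewrite state_ltE bot_least ?andbT; last exact: level_S0.
  by rewrite negbK eq_sym => /eqP.
rewrite state_ltE negb_and negbK; case: eqVneq => //= nT.
apply: contra nT => leT; apply/eqP/(hle_anti level_inj) => //.
exact/bot_least/level_S0.
Qed.

Lemma top_state : exists S1, forall S, hle H S S1.
Proof.
pose S1 := [arg max_(S > S0 | true) \sum_j H S j].
have maxS1 S : \sum_j H S j <= \sum_j H S1 j by rewrite /S1; case: arg_maxnP => // T _ maxT; apply: maxT.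
exists S1 => S; have [U UE] := level_max S S1.
have leS1U : hle H S1 U by apply/forallP => j; rewrite UE leq_maxr.
have [<-|nU] := eqVneq U S1; first by apply/forallP => j; rewrite UE leq_maxl.
have := maxS1 U; rewrite leqNgt (sum_height_lt level_inj) //; by rewrite eq_sym.
Qed.

(** * The maximal state and the dimension vector *)

Variable S1 : state i.
Hypothesis S1_max : forall S, hle H S S1.

Lemma maximal_stateE S : maximal_state S = (S == S1).
Proof.
apply/forallP/eqP => [maxS|-> T].
  by have := maxS S1; rewrite state_ltE S1_max andbT negbK => /eqP.
rewrite state_ltE negb_and negbK; case: eqVneq => //= nT.
by apply: contra nT => leT; apply/eqP/(hle_anti level_inj).
Qed.

Lemma transposition_seq_level S w T : transposition_seq S w T ->
  forall j, H T j = H S j + transposition_count j w.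
Proof.
elim: w S => [|[l U] w IHw] S /=; first by move=> /eqP-> j; rewrite addn0.
move=> /andP[/ccw_levelP UE /IHw wE] j; rewrite wE UE /transposition_count /= eq_sym.
by rewrite addnA.
Qed.

Lemma transposition_seq_exists S T : hle H S T -> exists w, transposition_seq S w T.
Proof.
rewrite -connect_hle => /connectP[p]; elim: p S => [|U p IHp] S /=.
  by move=> _ ->; exists [::]; rewrite /= eqxx.
move=> /andP[/existsP[j SU] /IHp{}IHp] /IHp[w wP].
by exists ((j, U) :: w); rewrite /= SU.
Qed.

(** A transposition at [j] raises the level at [j] alone by one, so every sequence from [S0] to [S1]
    gives the same count, and one exists. *)
Lemma state_dimE j : state_dim i j = H S1 j.
Proof.
rewrite /state_dim; set P := (fun n => exists S S' w, _); pose e := epsilon (inhabits 0) P.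
have [S [S' [w]]] : P e.
  apply: epsilon_spec; have [w wP] := transposition_seq_exists (S1_max S0).
  exists (transposition_count j w), S0, S1, w; split=> //.
    by rewrite minimal_stateE.
  by rewrite maximal_stateE.
rewrite minimal_stateE maximal_stateE -/e => -[/eqP-> /eqP-> wP countE].
by rewrite -countE (transposition_seq_level wP) level_S0.
Qed.

Lemma in_minimal_stateE d : in_minimal_state i (cr d, reg d) = mk S0 d.
Proof.
apply/existsP/idP => [[S /andP[]]|dS0]; first by rewrite minimal_stateE => /eqP->.
by exists S0; rewrite minimal_stateE eqxx.
Qed.

Lemma join_irreducibleP S :
  reflect (exists j m, least_at H S j m.+1) (join_irreducible S).
Proof.
apply: (equivP _ (join_irreducible_least level_inj level_min level_max level_bot level_step S)).
apply: (iffP andP) => -[nbot irr]; split.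
- by move=> bot; case/negP: nbot; apply/forallP => T; rewrite state_leE.
- move=> a b [ac bc abc]; have /forallP/(_ b) := forallP irr a.
  rewrite /is_join !state_leE ac bc /=.
  have -> : [forall u, state_le a u && state_le b u ==> state_le S u].
    by apply/forallP => u; rewrite !state_leE; apply/implyP => /andP[]; apply: abc.
  by move=> /orP[]/eqP ->; [left|right].
- by apply/forallP => bot; apply: nbot => T; rewrite -state_leE.
apply/forallP => a; apply/forallP => b; apply/implyP; rewrite /is_join !state_leE.
case/and3P => ac bc /forallP abc; apply/orP.
have /irr[->|->] : hjoin H a b S; [|by left|by right].
by split=> // u au bu; have := abc u; rewrite !state_leE au bu.
Qed.

(** * Basis elements and the least states they determine *)

Local Notation mk0 := (mk S0).
Variable k : fieldType.
Local Notation basis := (rep_basis (link_rep i k)).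
Implicit Types b : basis.

Definition bseg b : segment K := tag b.
(** Counted from one, like the index m of [b_{j,m}]. *)
Definition blev b : nat := (tagged b : nat).+1.

Lemma blev_le b : blev b <= state_dim i (bseg b).
Proof. exact: ltn_ord. Qed.

Lemma basis_ext b b' : bseg b = bseg b' -> blev b = blev b' -> b = b'.
Proof.
case: b b' => [j m] [j' m']; rewrite /bseg /blev /= => jj'; case: _ / jj' in m' * => -[mm'].
by congr existT; apply: val_inj.
Qed.

Lemma basis_exists j m : m < state_dim i j -> exists b, bseg b = j /\ blev b = m.+1.
Proof.
move=> lt_m; pose I (l : vertex (diagram_quiver K)) := 'I_(rep_dim (link_rep i k) l).
by exists (existT I j (Ordinal lt_m)).
Qed.

Lemma gen_exists b : exists c, least_at H c (bseg b) (blev b).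
Proof.
apply: (least_at_exists level_inj (level_min) (S := S1)).
by rewrite -state_dimE blev_le.
Qed.

Definition gen b : state i := sval (constructive_indefinite_description _ (gen_exists b)).

Lemma genP b : least_at H (gen b) (bseg b) (blev b).
Proof. by rewrite /gen; case: constructive_indefinite_description. Qed.

Lemma gen_inj : injective gen.
Proof.
move=> b b' eqg; have := genP b; rewrite eqg => lb.
have [bb' mm'] := least_at_inj level_inj (level_bot) (level_step) lb (genP b').
exact: basis_ext bb' (congr1 S mm').
Qed.

Lemma gen_le b S : hle H (gen b) S = (blev b <= H S (bseg b)).
Proof.
have [lg ming] := genP b; apply/idP/idP => [/forallP leS|]; last exact: ming.
exact: leq_trans (leS _).
Qed.

(** An arrow of the coefficient quiver along the corner of [d], as it would be before 2-cycles are
    removed. *)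
Definition arrow_at d b b' :=
  [/\ bseg b = seg d, bseg b' = seg (r d) & blev b = blev b' + mk0 d].

Lemma arrow_at_next b d : bseg b = seg d -> mk0 d < blev b -> exists b', arrow_at d b b'.
Proof.
move=> bd ltb; have [|b' [b's b'l]] := @basis_exists (seg (r d)) (blev b - mk0 d).-1.
  have := blev_le b; have := level_rot S1 d; rewrite !state_dimE bd; lia.
by exists b'; split=> //; rewrite b'l; lia.
Qed.

(** The level of [gen b] drops by at most [mk0 d] along the corner, so [gen b] attains the level of
    [b'] at its segment. *)
Lemma arrow_at_le d b b' : arrow_at d b b' -> hle H (gen b') (gen b).
Proof.
move=> [bd b'd lv]; rewrite gen_le b'd; have := level_rot (gen b) d.
by have [+ _] := genP b; rewrite bd; lia.
Qed.

Lemma arrow_at_neq d b b' : arrow_at d b b' -> b' != b.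
Proof.
move=> [bd b'd _]; apply: contraNneq (seg_rot_neq d).
by rewrite -bd -b'd => ->.
Qed.

(** * Reachability along the arrows of all corners *)

Definition any_arrow : rel basis :=
  [rel b b' | [exists d, [&& bseg b == seg d, bseg b' == seg (r d) & blev b == blev b' + mk0 d]]].

Lemma any_arrowP b b' : reflect (exists d, arrow_at d b b') (any_arrow b b').
Proof.
apply: (iffP existsP) => -[d]; first by case/and3P => /eqP ? /eqP ? /eqP ?; exists d.
by case=> ? ? ?; exists d; apply/and3P; split; apply/eqP.
Qed.

Lemma sum_mk0 d : mk0 d + mk0 (r d) + mk0 (r (r d)) + mk0 (r (r (r d))) = 1.
Proof.
rewrite -(card_mk_cr S0 (cr d)).
by rewrite -[RHS]natn -(@sum_mk nat S0 (fun e => cr e == cr d)) sum_cr !natn.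
Qed.

(* The four corners at a crossing point contain exactly one marker of the minimal
   state, so that going around it lowers the level by one. *)
Lemma level_down b b' :
  bseg b = bseg b' -> blev b' <= blev b -> connect any_arrow b b'.
Proof.
move=> bb'; have [n] := ubnP (blev b - blev b'); elim: n b bb' => // n IHn b bb'.
rewrite ltnS => len; rewrite leq_eqVlt => /orP[/eqP eqb|ltb].
  by rewrite (basis_ext bb' (esym eqb)) connect0.
have [d bd] := seg_surj (bseg b); have := sum_mk0 d; have lb' : 0 < blev b' by [].
have step c e : bseg c = seg e -> mk0 e < blev c -> exists2 c', connect any_arrow c c' &
    bseg c' = seg (r e) /\ blev c = blev c' + mk0 e.
  move=> ce /(arrow_at_next ce)[c' ac]; exists c'; last by case: ac.
  by apply/connect1/any_arrowP; exists e.
have [|c1 con1 [c1d lv1]] := step b d bd; first by move: ltb lb'; case: (mk0 d) => /=; lia.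
move=> sum1.
have [|c2 con2 [c2d lv2]] := step c1 _ c1d; first by move: lb' ltb lv1 sum1; lia.
have [|c3 con3 [c3d lv3]] := step c2 _ c2d; first by move: lb' ltb lv1 lv2 sum1; lia.
have [|c4 con4 [c4d lv4]] := step c3 _ c3d; first by move: lb' ltb lv1 lv2 lv3 sum1; lia.
apply: connect_trans con1 (connect_trans con2 (connect_trans con3 (connect_trans con4 _))).
by apply: IHn; [rewrite c4d rot4 -bd | move: len ltb lv1 lv2 lv3 lv4 sum1; lia..].
Qed.

(* The reachable elements define a height function, hence a state; it lies
   above [gen b]. *)
Lemma any_arrow_complete b b' : hle H (gen b') (gen b) -> connect any_arrow b b'.
Proof.
(* [h j] is the highest level reachable at [j], and 0 if nothing is reachable there. *)
move=> leb; pose h j := \max_(c : basis | connect any_arrow b c && (bseg c == j)) blev c.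
have h_ge c : connect any_arrow b c -> blev c <= h (bseg c).
  by move=> con; rewrite /h (bigD1 c) ?con ?eqxx //= leq_maxl.
have h_in j : 0 < h j -> exists c, [/\ connect any_arrow b c, bseg c = j & blev c = h j].
  move=> hj; have [|c /andP[con /eqP cj] cE] := @eq_bigmax_cond basis
    [pred c | connect any_arrow b c && (bseg c == j)] blev.
    rewrite lt0n; apply: contraTneq hj => /card0_eq none.
    by rewrite -eqn0Ngt /h big_pred0 // => c; have := none c; rewrite inE.
  by exists c; split=> //; rewrite /h cE.
have h_arrow d : h (seg d) <= h (seg (r d)) + mk0 d.
  have [hd|] := leqP (h (seg d)) (mk0 d); first by apply: leq_trans hd (leq_addl _ _).
  move=> ltd; have [|c [con cd cl]] := h_in (seg d); first by apply: leq_ltn_trans ltd.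
  have [|c' ac] := arrow_at_next cd; first by rewrite cl.
  have [_ c'd lv] := ac; rewrite -cl lv leq_add2r -c'd h_ge //.
  by apply: connect_trans con (connect1 _); apply/any_arrowP; exists d.
(* The upper bound on the increment comes from [h_arrow] at the three other corners of the crossing
   point. *)
have h_cycle d : h (seg (r d)) + mk0 d <= (h (seg d)).+1.
  have := sum_mk0 d; have := h_arrow (r d); have := h_arrow (r (r d)).
  by have := h_arrow (r (r (r d))); rewrite rot4; lia.
have hi : h i = 0.
  apply/eqP; rewrite -leqn0 leqNgt; apply/negP => /h_in[c [_ ci _]].
  by have := blev_le c; rewrite state_dimE ci level_i.
have [|d|T [_ TE]] := @state_of_height S0 (fun j => Posz (h j))
  (fun d => h (seg (r d)) + mk0 d == (h (seg d)).+1).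
- by rewrite hi.
- by have := h_arrow d; have := h_cycle d; case: (mk0 d); case: eqP => /=; lia.
have HT j : H T j = h j by rewrite /level TE.
have : hle H (gen b') T.
  by apply: hle_trans leb _; rewrite gen_le HT h_ge ?connect0.
rewrite gen_le HT => leb'; have [|c [con cb' cl]] := h_in (bseg b'); first exact: leq_trans leb'.
by apply: connect_trans con (level_down cb' _); rewrite cl.
Qed.

(** * Removed 2-cycles and the order of the coefficient quiver *)

Lemma in_2cycleP d : in_2cycle d -> next_side K d = f (r d).
Proof.
(* The first three cases contradict the distinctness of the darts at a crossing point or the absence
   of loops; in the last one the region of [d] is a bigon. *)
case/existsP => e; rewrite !segE => /andP[/orP[]/eqP-> /orP[]/eqP].
- by have := rot_orbit_uniq d; rewrite /= !inE => /andP[/norP[_ /norP[/eqP nd _]]] _ /esym.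
- by move=> fd; have := no_loop d; rewrite -fd !cr_rot eqxx.
- by move=> rd; have := no_loop (r d); rewrite -[cr (f _)]cr_rot rd cr_rot eqxx.
by move=> rd; apply: (@perm_inj _ r); rewrite rot_next.
Qed.

(** The bigon contains exactly one marker of [S0], so the three corners other than [e] at the
    crossing point of [e] lower the level by [1 - mk0 e = mk0 d] in total, just as [d] does. *)
Lemma bigon_detour d b b' : in_2cycle d -> arrow_at d b b' ->
  exists c1 c2 e1 e2 e3, [/\ arrow_at e1 b c1, arrow_at e2 c1 c2 & arrow_at e3 c2 b'].
Proof.
move=> /in_2cycleP nd [bd b'd lv]; set e := f (r d).
have re : r e = f d by rewrite /e -nd rot_next.
have ne : next_side K e = d by rewrite next_flip_rot.
(* The bigon is not adjacent to [i], since the space at [seg d] is nonzero. *)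
have mk_de : mk0 d + mk0 e = 1.
  have := card_mk_reg S0 (reg d).
  have [adj|_] := boolP (adjacent i (reg d)).
    by have := blev_le b; rewrite bd state_dimE /level ht_adjacent // -bd.
  rewrite -[LHS]natn -(@sum_mk nat S0 (fun c => reg c == reg d)).
  rewrite (bigD1 d) //= (bigD1 e) /=; last first.
    rewrite /e reg_flip_rot eqxx /=; apply: contra_neq (seg_rot_neq d) => ed.
    by rewrite -seg_flip ed.
  rewrite big1 ?addr0 => [|c /andP[/andP[/eqP cd ncd] nce]]; first by rewrite !natn.
  have : (c == d) || (c == e).
    apply: (reg_invariant (P := fun c => (c == d) || (c == e)) (d := d)) => //; last by rewrite eqxx.
    by move=> c' _ /orP[]/eqP->; rewrite ?nd ?ne eqxx ?orbT.
  by rewrite (negPf ncd) (negPf nce).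
have := sum_mk0 e => sum_e.
have [||c1 a1] := @arrow_at_next b (r e); first by rewrite re seg_flip.
  by move: lv mk_de sum_e; rewrite /blev; lia.
have [_ c1e lv1] := a1.
have [|c2 a2] := arrow_at_next c1e; first by move: lv lv1 mk_de sum_e; rewrite /blev; lia.
have [_ c2e lv2] := a2.
exists c1, c2, (r e), (r (r e)), (r (r (r e))); split=> //; split=> //.
  by rewrite b'd rot4 seg_flip.
by move: lv lv1 lv2 mk_de sum_e; lia.
Qed.

Lemma coef_arrowP b b' :
  reflect (exists2 d, ~~ in_2cycle d & arrow_at d b b') (coef_arrow b b').
Proof.
have entry (a : arrow (diagram_quiver K)) (m : 'I_(state_dim i (source a)))
    (m' : 'I_(state_dim i (target a))) :
    (((delta_mx 0 m : 'rV[k]_(state_dim i (source a))) *m arrow_matrix i k a) 0 m' != 0)%R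
      = (m == m' + mk0 (val a) :> nat).
  rewrite -rowE !mxE (in_minimal_stateE); apply: (@matrix_entry_neq0 k _ _ _ _ _ (mk S1 (val a))).
  by rewrite !state_dimE level_rot.
apply: (iffP existsP) => [[a /existsP[m /existsP[m' /and3P[/eqP-> /eqP->]]]]|[d nd ad]].
  rewrite entry => /eqP mE; exists (val a); first exact: (valP a).
  by split; [ | | rewrite /blev mE].
have [bd b'd lv] := ad.
pose a : arrow (diagram_quiver K) := Sub d nd.
case: b b' bd b'd lv {ad} => [j m] [j' m']; rewrite /bseg /blev /= => jd j'd.
case: _ / (esym jd) m => m; case: _ / (esym j'd) m' => m' lv.
exists a; apply/existsP; exists m; apply/existsP; exists m'.
by rewrite !eqxx entry /=; move/eqP: lv; rewrite addSn eqSS.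
Qed.

(** The arrows of a detour may lie in 2-cycles themselves; the recursion ends because each of them
    covers a strictly smaller drop in the total height of the least states. *)
Lemma arrow_at_connect d b b' : arrow_at d b b' -> connect (@coef_arrow k _ (link_rep i k)) b b'.
Proof.
pose size_of c := \sum_j H (gen c) j.
have shrink e c c' : arrow_at e c c' -> size_of c' < size_of c.
  move=> ac; apply: (sum_height_lt level_inj (arrow_at_le ac)).
  by rewrite (inj_eq gen_inj) (arrow_at_neq ac).
have [n] := ubnP (size_of b - size_of b'); elim: n d b b' => // n IHn d b b'.
rewrite ltnS => len ad; have [d2|d2] := boolP (in_2cycle d); last first.
  by apply/connect1/coef_arrowP; exists d.
have [c1 [c2 [e1 [e2 [e3 [a1 a2 a3]]]]]] := bigon_detour d2 ad.
have := shrink _ _ _ a1; have := shrink _ _ _ a2; have := shrink _ _ _ a3 => lt3 lt2 lt1.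
apply: connect_trans (IHn _ _ _ _ a1) (connect_trans (IHn _ _ _ _ a2) (IHn _ _ _ _ a3)); lia.
Qed.

Lemma coef_leE b b' : coef_le b b' = hle H (gen b) (gen b').
Proof.
apply/idP/idP => [/connectP[p]|/any_arrow_complete].
  elim: p b' => [|c p IHp] b' /=; first by move=> _ ->; apply: hle_refl.
  move=> /andP[/coef_arrowP[d _ /arrow_at_le lec] pth] /(IHp _ pth) leb.
  exact: hle_trans leb lec.
apply: connect_sub => c c' /any_arrowP[d]; exact: arrow_at_connect.
Qed.

Lemma gen_join_irreducible b : join_irreducible (gen b).
Proof. by apply/join_irreducibleP; exists (bseg b), (tagged b : nat); apply: genP. Qed.

Lemma join_irreducible_gen S : join_irreducible S -> exists b, gen b = S.
Proof.
case/join_irreducibleP => j [m lS]; have [mS minS] := lS.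
have [|b [bj bm]] := @basis_exists j m.
  by rewrite state_dimE; apply: leq_trans mS (forallP (S1_max S) j).
exists b; apply: (hle_anti level_inj); first by rewrite gen_le bj bm.
by apply: minS; have [] := genP b; rewrite bj bm.
Qed.

End Diagram.

Theorem theorem1p3 (k : closedFieldType) (K : diagram) (i : segment K) :
  cellular K -> prime_diagram K -> without_curls K ->
  exists f : {S : state i | join_irreducible S} -> rep_basis (link_rep i k),
    bijective f /\
    forall S S', state_le (val S) (val S') = coef_le (f S) (f S').
Proof.
move=> K_cell [_ K_prime] K_nocurl.
have [S0 S0_min] := min_state K_cell K_prime K_nocurl i.
have [S1 S1_max] := top_state S0_min.
(* The isomorphism is constructed from the basis to the join irreducible states and then
   inverted. *)
pose g b : {S : state i | join_irreducible S} :=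
  Sub (gen (k := k) S0_min S1_max b) (gen_join_irreducible S0_min S1_max b).
have g_inj : injective g by move=> b b' /(congr1 val); apply: gen_inj.
have g_surj S : exists b, g b = S.
  have [b bS] := join_irreducible_gen S0_min S1_max k (valP S).
  by exists b; apply: val_inj.
pose h S := sval (constructive_indefinite_description _ (g_surj S)).
have hK S : g (h S) = S by rewrite /h; case: constructive_indefinite_description.
exists h; split; first by exists g => // b; apply: g_inj; rewrite hK.
move=> S S'; rewrite (coef_leE S0_min S1_max) (state_leE S0_min).
by rewrite -{1}(hK S) -{1}(hK S').
Qed.
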